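(* Let $G$ be a countable amenable group which is not finitely generated. Then there is no comeager conjugacy class in $\Xi(G)$. If $G$ is locally finite, there is also no comeager conjugacy class in $\Xi_{\mathrm{min}}(G)$.
   Context: $\Omega$ denotes the Cantor space; $\mathrm{Homeo}(\Omega)$ carries the uniform convergence topology. $\Xi(G)=\mathrm{Hom}(G,\mathrm{Homeo}(\Omega))$ is the Polish space of actions of the countable group $G$ on $\Omega$ by homeomorphisms, a closed subspace of $\mathrm{Homeo}(\Omega)^G$. $\mathrm{Homeo}(\Omega)$ acts on it by conjugation, $(f\cdot\xi)(g)=f\xi(g)f^{-1}$; orbits are called conjugacy classes. $\Xi_{\mathrm{min}}(G)$ is the set of $\xi\in\Xi(G)$ which are minimal, i.e., such that $\Omega$ has no proper non-empty closed $\xi$-invariant subset; it is a conjugation-invariant $G_\delta$ subset of $\Xi(G)$, hence a Polish space in the subspace topology. A group is locally finite if all of its finitely generated subgroups are finite. *)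

(* Defs.v *)
From HB Require Import structures.
From mathcomp Require Import all_boot all_order all_algebra.
From mathcomp Require Import all_classical all_reals all_analysis.
From mathcomp Require Import borel_hierarchy.

Set Implicit Arguments.
Unset Strict Implicit.
Unset Printing Implicit Defensive.

Local Open Scope classical_set_scope.
Local Open Scope ring_scope.

Section GroupProperties.
Variable G : groupType.

Definition subgroup (H : set G) : Prop :=
  [/\ H 1%g, forall x y, H x -> H y -> H (x * y)%g & forall x, H x -> H (x^-1)%g].

Definition finitely_generated (H : set G) : Prop :=
  exists2 S : set G, finite_set S & H = smallest subgroup S.

Definition locally_finite : Prop :=
  forall H : set G, finitely_generated H -> finite_set H.

(* A left-invariant finitely additive probability measure on all subsets. *)
Definition amenable (R : realType) : Prop :=
  exists m : set G -> R,
    [/\ forall A, 0 <= m A,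
        m setT = 1,
        forall A B, A `&` B = set0 -> m (A `|` B) = m A + m B
      & forall (g : G) A, m [set (g * x)%g | x in A] = m A].

End GroupProperties.

Definition comeager (T : topologicalType) (A : set T) : Prop :=
  exists2 D : set T, Gdelta_dense D & D `<=` A.

Record homeo := Homeo {
  homeo_fun :> cantor_space -> cantor_space;
  homeo_inv : cantor_space -> cantor_space;
  homeo_funK : cancel homeo_fun homeo_inv;
  homeo_invK : cancel homeo_inv homeo_fun;
  homeo_fun_continuous : continuous homeo_fun;
  homeo_inv_continuous : continuous homeo_inv }.

Lemma homeo_eq (f g : homeo) : homeo_fun f =1 homeo_fun g -> f = g.
Proof.
case: f g => [f f' fK f'K cf cf'] [g g' gK g'K cg cg'] /= fg.
have {}fg : f = g by exact: funext.
have fg' : f' = g' by apply: funext => x; rewrite -{1}[x]g'K -fg fK.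
move: g g' fg fg' gK g'K cg cg' => g g' <- <- gK g'K cg cg'.
by congr Homeo; exact: Prop_irrelevance.
Qed.

HB.instance Definition _ := gen_eqMixin homeo.
HB.instance Definition _ := gen_choiceMixin homeo.

Definition homeo_one : homeo :=
  @Homeo id id (fun=> erefl) (fun=> erefl) (fun _ _ => id) (fun _ _ => id).

Definition homeo_inverse (f : homeo) : homeo :=
  Homeo (@homeo_invK f) (@homeo_funK f)
    (@homeo_inv_continuous f) (@homeo_fun_continuous f).

Definition homeo_comp (f g : homeo) : homeo :=
  Homeo (can_comp (@homeo_funK f) (@homeo_funK g))
    (can_comp (@homeo_invK g) (@homeo_invK f))
    (fun x => continuous_comp
      (@homeo_fun_continuous g x) (@homeo_fun_continuous f (g x)))
    (fun x => continuous_comp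
      (@homeo_inv_continuous f x) (@homeo_inv_continuous g (homeo_inv f x))).

Fact homeo_compA : associative homeo_comp.
Proof. by move=> f g h; exact: homeo_eq. Qed.
Fact homeo_comp1f : left_id homeo_one homeo_comp.
Proof. by move=> f; exact: homeo_eq. Qed.
Fact homeo_compf1 : right_id homeo_one homeo_comp.
Proof. by move=> f; exact: homeo_eq. Qed.
Fact homeo_compVf : left_inverse homeo_one homeo_inverse homeo_comp.
Proof. by move=> f; apply: homeo_eq => x /=; rewrite homeo_funK. Qed.
Fact homeo_compfV : right_inverse homeo_one homeo_inverse homeo_comp.
Proof. by move=> f; apply: homeo_eq => x /=; rewrite homeo_invK. Qed.

HB.instance Definition _ := isGroup.Build homeo
  homeo_compA homeo_comp1f homeo_compf1 homeo_compVf homeo_compfV.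

HB.instance Definition _ := Uniform.copy homeo
  (initial_topology (homeo_fun : homeo -> {uniform cantor_space -> cantor_space})).

Section Actions.
Variable G : groupType.

Definition Xi : Type := UMagmaMorphism.type G homeo.

HB.instance Definition _ := gen_eqMixin Xi.
HB.instance Definition _ := gen_choiceMixin Xi.

Definition Xi_val (xi : Xi) : prod_topology (fun _ : G => homeo) :=
  fun g : G => xi g.

HB.instance Definition _ := Uniform.copy Xi (initial_topology Xi_val).

Definition conj_fun (f : homeo) (xi : Xi) (g : G) : homeo :=
  (f * xi g * f^-1)%g.

Fact conj_fun_morph (f : homeo) (xi : Xi) : monoid_morphism (conj_fun f xi).
Proof.
split=> [|x y]; rewrite /conj_fun; first by rewrite gmulf1 mulg1 mulgV.
by rewrite gmulfM !mulgA mulgVK.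
Qed.

HB.instance Definition _ (f : homeo) (xi : Xi) :=
  isUMagmaMorphism.Build G homeo (conj_fun f xi) (conj_fun_morph f xi).

Definition conj_action (f : homeo) (xi : Xi) : Xi := conj_fun f xi.

Definition conjugacy_class (xi : Xi) : set Xi :=
  [set conj_action f xi | f in [set: homeo]].

Definition minimal_action (xi : Xi) : Prop :=
  forall A : set cantor_space, closed A -> A !=set0 ->
    (forall g x, A x -> A (xi g x)) -> A = setT.

(* As a type, [Xi_min] carries the subspace topology of [Xi]. *)
Definition Xi_min : set Xi := [set xi | minimal_action xi].

Definition conjugacy_class_min (xi : Xi_min) : set Xi_min :=
  set_val @^-1` conjugacy_class (set_val xi).

End Actions.

Arguments Xi_min : clear implicits.

(* Main.v *)
Require Import Defs.
From HB Require Import structures.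
From mathcomp Require Import all_boot all_order all_algebra.
From mathcomp Require Import all_classical all_reals all_analysis.
From mathcomp Require Import borel_hierarchy.
From mathcomp Require Import zify.

(* The sets of finite 0-1 patterns that the orbits of an action trace through
   the clopen set [head_bit] are locally constant on [Xi G], whereas along one
   conjugacy class only countably many families of patterns occur, one for each
   clopen set.  Hence a class can be comeager only if the patterns are constant
   on some basic open set.  Such a set only prescribes, up to finite precision,
   the action of a finitely generated proper subgroup [H].

   If [G] is locally finite, [H] is finite, and inverse limits of finite
   subgroups [K n], starting from a large finite [K 0] containing [H], give
   minimal actions; they have at most [#|K 0|] patterns on [K 0], but there are
   exponentially many ways to choose which patterns these are.

   Otherwise a ray in an infinite finitely generated subgroup yields an
   injective, non-surjective piecewise translation of [G], hence an action where
   the clopen set [head_bit] is forced to be null for every invariant mean.  By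
   amenability, the system coinduced from [H] contains a point whose orbit
   avoids [head_bit].  Therefore the visits to [head_bit] can be confined to one
   coset of [H], which changes the patterns of the coinduced system. *)

Set Implicit Arguments.
Unset Strict Implicit.
Unset Printing Implicit Defensive.

Local Open Scope classical_set_scope.

(** * Cylinders and basic neighbourhoods *)

Definition agree (n : nat) (x y : cantor_space) : Prop :=
  forall i, (i < n)%N -> x i = y i.

Lemma agree_sym n x y : agree n x y -> agree n y x.
Proof. by move=> xy i /xy. Qed.

Lemma agree_trans n x y z : agree n x y -> agree n y z -> agree n x z.
Proof. by move=> xy yz i ltin; rewrite xy ?yz. Qed.

Lemma agree_le m n x y : (m <= n)%N -> agree n x y -> agree m x y.
Proof. by move=> lemn xy i ltim; apply: xy; exact: leq_trans lemn. Qed.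

Lemma agreeP x y : (forall n, agree n x y) -> x = y.
Proof. by move=> xy; apply: functional_extensionality_dep => i; exact: (xy i.+1). Qed.

Lemma entourage_agree n :
  @entourage cantor_space [set p | agree n p.1 p.2].
Proof.
elim: n => [|n IHn]; first by apply: filterS filterT => p _ i.
have En : @entourage cantor_space [set p | p.1 n = p.2 n].
  pose e : set (cantor_space * cantor_space) := [set p | p.1 n = p.2 n].
  have ent : `[< @entourage (initial_topology (@proj nat (fun=> bool) n)) e >].
    apply/asboolP; exists [set p : bool * bool | p.1 = p.2] => //.
    by move=> _ [b _ <-].
  exists e => //; apply: (@finI_from1 _ _ _ _ (@exist _ _ (n : {classic nat}, e) ent)).
  by [].
apply: filterS (filterI IHn En) => p [/= a b] i; rewrite ltnS leq_eqVlt.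
by move=> /orP[/eqP->|/a].
Qed.

(** The uniformity is generated by finite intersections of preimages of entourages of single
    coordinates, and the generator for coordinate [i] already contains [agree i.+1]. *)
Lemma entourage_agreeP (E : set (cantor_space * cantor_space)) :
  entourage E -> exists n, [set p | agree n p.1 p.2] `<=` E.
Proof.
case=> A [D _ <-] DE.
pose F := filter_from [set: nat] (fun n => [set p | agree n p.1 p.2]).
have FF : Filter F.
  apply: filter_from_filter; first by exists 0.
  move=> i j _ _; exists (maxn i j) => // p p12; split; apply: agree_le p12.
    exact: leq_maxl.
  exact: leq_maxr.
suff : F E by case=> n _ nE; exists n.
apply: filterS DE _; apply: filter_bigI => -[ [i e] /= ent] _.
have [B Bent Be] := asboolW ent.
exists i.+1 => // -[x y] xy; apply: Be. move: (xy i (ltnSn i)) => /= xyi.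
have := entourage_refl (x i) Bent; rewrite {2}xyi. exact.
Qed.

Lemma nbhs_agree n (x : cantor_space) : nbhs x [set y | agree n x y].
Proof.
apply/nbhsP; exists [set p | agree n p.1 p.2]; first exact: entourage_agree.
by move=> y /xsectionP.
Qed.

Lemma nbhs_agreeP (x : cantor_space) (U : set cantor_space) :
  nbhs x U -> exists n, [set y | agree n x y] `<=` U.
Proof.
move=> /nbhsP [E /entourage_agreeP [n nE] EU].
by exists n => y xy; apply: EU; apply/xsectionP; exact: nE.
Qed.

Lemma continuous_agreeP (f : cantor_space -> cantor_space) :
  continuous f <->
  forall x n, exists m, forall y, agree m x y -> agree n (f x) (f y).
Proof.
split=> [cf x n|cf x U /nbhs_agreeP [n nU]].
  by have /nbhs_agreeP [m mP] := cf x _ (nbhs_agree n (f x)); exists m.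
have [m mP] := cf x n; apply: filterS (nbhs_agree m x) => y /mP.
exact: nU.
Qed.

(** Near each point a single stage [n] works, finitely many such neighbourhoods cover the space, and
    by monotonicity the largest of these stages works everywhere. *)
Lemma cantor_compactness (P : nat -> cantor_space -> Prop) :
  (forall m n x, (m <= n)%N -> P m x -> P n x) ->
  (forall x, exists n, forall y, agree n x y -> P n y) ->
  exists n, forall x, P n x.
Proof.
move=> monoP locP.
have /compact_near_coveringP/(_ nat \oo P _) := cantor_space_compact.
case=> [x _|n _ /(_ n)]; last by move=> /(_ (leqnn n)) Pn; exists n => x; exact: Pn.
have [n nP] := locP x.
exists ([set y | agree n x y], [set m | (n <= m)%N]).
  by split; [exact: nbhs_agree|exists n].
by move=> [y m] [/= /nP Py nm] /=; exact: monoP nm Py.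
Qed.

Lemma continuous_agree_unif (f : cantor_space -> cantor_space) n :
  continuous f ->
  exists m, forall x y, agree m x y -> agree n (f x) (f y).
Proof.
move=> /continuous_agreeP cf.
pose P m x := forall y, agree m x y -> agree n (f x) (f y).
apply: (@cantor_compactness P) => [m k x lemk Pm y xy|x].
  by apply: Pm; exact: agree_le xy.
have [m mP] := cf x n; exists m => y xy z yz.
by apply: agree_trans (agree_sym (mP _ xy)) (mP _ (agree_trans xy yz)).
Qed.

Section ActionTopology.
Variable G : groupType.

Definition action_nbhs (xi : Xi G) (F : seq G) (N : nat) : set (Xi G) :=
  [set eta : Xi G | forall g, g \in F -> forall x, agree N (xi g x) (eta g x)].

Lemma nbhs_homeo (f : homeo) N :
  nbhs f [set h : homeo | forall x, agree N (f x) (h x)].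
Proof.
have cf : {for f, continuous
    (homeo_fun : homeo -> {uniform cantor_space -> cantor_space})}.
  exact: initial_continuous.
apply: (cf [set h | forall x, agree N (f x) (h x)]).
apply/uniform_nbhs; exists [set p | agree N p.1 p.2].
by split; [exact: entourage_agree|move=> h fh x; exact: fh].
Qed.

Lemma nbhs_action_nbhs xi F N : nbhs xi (action_nbhs xi F N).
Proof.
elim: F => [|g F IHF]; first by apply: filterS filterT => eta _ g.
have := @initial_continuous (Xi G) (prod_topology (fun _ : G => homeo)) (@Xi_val G) xi.
move=> /(_ ((fun h : prod_topology (fun _ : G => homeo) => h g) @^-1`
  [set h : homeo | forall x, agree N (xi g x) (h x)])).
move=> /(_ (@proj_continuous G (fun=> homeo) g (Xi_val xi) _ (nbhs_homeo (xi g) N))) ng.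
apply: filterS (filterI IHF ng) => eta [/= etaF etag] h.
by rewrite inE => /orP[/eqP->|/etaF].
Qed.

(** The filter generated by the basic sets converges to [xi]; this is checked through the layers
    that define the topology, namely the product over [G], each coordinate in [homeo], and uniform
    convergence. *)
Lemma nbhs_action_nbhsP xi (U : set (Xi G)) :
  nbhs xi U -> exists F N, action_nbhs xi F N `<=` U.
Proof.
pose B := filter_from [set: seq G * nat] (fun p => action_nbhs xi p.1 p.2).
have FB : Filter B.
  apply: filter_from_filter; first by exists ([::], 0).
  move=> [F M] [F' N] _ _; exists (F ++ F', maxn M N) => //= eta etaV.
  split=> g gF x; [apply: agree_le (leq_maxl M N) _|apply: agree_le (leq_maxr M N) _];
    by apply: etaV; rewrite mem_cat gF ?orbT.
suff BU : B --> xi by move=> /BU [ [F N] _ VU]; exists F, N.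
have init_cvg (S : choiceType) (T : topologicalType) (f : S -> T)
    (F : set_system S) (s : S) :
    Filter F -> f @ F --> f s -> F --> (s : initial_topology f).
  move=> FF fF A [_ [[C oC <-] Cs CA]].
  apply: filterS CA _; apply: fF; exact: open_nbhs_nbhs.
apply: (@init_cvg (Xi G) (prod_topology (fun _ : G => homeo)) (@Xi_val G)).
apply/cvg_sup => g.
apply: (@init_cvg _ homeo (fun f : prod_topology (fun _ : G => homeo) => f g)).
apply: (@init_cvg homeo {uniform cantor_space -> cantor_space} homeo_fun).
move=> A /uniform_nbhs [E [/entourage_agreeP [n nE] EA]].
exists ([:: g], n) => // eta etaV; apply: EA => x _.
by apply: nE => /=; apply: etaV; rewrite inE.
Qed.
End ActionTopology.

(** * Coding perfect sets and realizing actions *)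

Section CantorCoding.
Variables (T : Type) (iota : T -> cantor_space) (M : nat).
Hypothesis iota_inj : injective iota.
Hypothesis iota_closed :
  forall x, (forall n, exists t, agree n x (iota t)) -> exists t, iota t = x.
Hypothesis iota_perfect :
  forall t n, exists t', t' <> t /\ agree n (iota t) (iota t').
Hypothesis iota_full : forall x, exists t, agree M x (iota t).

(** The range of [iota] is viewed as a tree of prefixes: [branch] detects nodes with two children,
    [forced] is the only child at the other nodes of the tree, and [nbranch] counts the branching
    nodes passed so far. *)
Let branch (x : cantor_space) n : bool :=
  `[< exists t t', [/\ agree n x (iota t), agree n x (iota t')
                     & iota t n <> iota t' n] >].

Let forced (x : cantor_space) n : bool :=
  `[< exists2 t, agree n x (iota t) & iota t n = true >].

Let nbranch (x : cantor_space) n := (\sum_(i < n) branch x i)%N.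

Let branch_agree n x y : agree n x y -> branch x n = branch y n.
Proof.
move=> xy; apply: asbool_equiv_eq; split=> -[t [t' [h h' ne]]]; exists t, t';
  split=> //; (apply: agree_trans; [|eassumption]) => //; exact: agree_sym.
Qed.

Let forced_agree n x y : agree n x y -> forced x n = forced y n.
Proof.
move=> xy; apply: asbool_equiv_eq; split=> -[t h ne]; exists t => //;
  (apply: agree_trans; [|eassumption]) => //; exact: agree_sym.
Qed.

Let nbranch_agree n x y : agree n x y -> nbranch x n = nbranch y n.
Proof.
move=> xy; apply: eq_bigr => i _; congr nat_of_bool; apply: branch_agree.
exact: agree_le (ltnW (ltn_ord i)) xy.
Qed.

Let nbranchS x n : nbranch x n.+1 = (nbranch x n + branch x n)%N.
Proof. by rewrite /nbranch big_ord_recr. Qed.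

Let nbranch_le x n : (nbranch x n <= n)%N.
Proof.
elim: n => [|n IHn]; first by rewrite /nbranch big_ord0.
by rewrite nbranchS -addn1 leq_add// leq_b1.
Qed.

Let nbranch_mono x m n : (m <= n)%N -> (nbranch x m <= nbranch x n)%N.
Proof.
move=> /subnK <-; elim: (n - m)%N => // k IHk.
by rewrite addSn nbranchS (leq_trans IHk)// leq_addr.
Qed.

Let nbranch_inj x m n : branch x m -> branch x n ->
  nbranch x m = nbranch x n -> m = n.
Proof.
wlog lemn : m n / (m <= n)%N => [hwlog bm bn e|bm bn e].
  have [/hwlog|/ltnW /hwlog h] := leqP m n; first exact.
  exact/esym/h.
apply/eqP; rewrite eqn_leq lemn leqNgt; apply/negP => /(nbranch_mono x).
by rewrite nbranchS bm e addn1 ltnn.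
Qed.

(* A point [o] is decoded by walking down the tree of prefixes of the range of
   [iota], reading one bit of [o] at each node with two children. *)
Let step (o : cantor_space) (p : cantor_space * nat) n : cantor_space * nat :=
  (fun i => if i == n then if branch p.1 n then o p.2 else forced p.1 n
            else p.1 i, (p.2 + branch p.1 n)%N).

Let walk (o : cantor_space) := fix walk n :=
  if n is m.+1 then step o (walk m) m else ((fun=> false) : cantor_space, 0%N).

Let decode (o : cantor_space) : cantor_space := fun n => (walk o n.+1).1 n.

Let walk_agree o n : agree n (walk o n).1 (decode o).
Proof.
elim: n => [//|n IHn] i; rewrite ltnS leq_eqVlt => /orP[/eqP -> //|ltin].
by rewrite -IHn//= ltn_eqF.
Qed.

Let walk_nbranch o n : (walk o n).2 = nbranch (decode o) n.
Proof.
elim: n => [|n IHn]; first by rewrite /nbranch big_ord0.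
by rewrite nbranchS /= IHn (branch_agree (@walk_agree o n)).
Qed.

Let decodeE o n : decode o n =
  if branch (decode o) n then o (nbranch (decode o) n) else forced (decode o) n.
Proof.
rewrite {1}/decode /= eqxx walk_nbranch.
by rewrite (branch_agree (@walk_agree o n)) (forced_agree (@walk_agree o n)).
Qed.

Let agree_next n (x y : cantor_space) :
  agree n x y -> x n = y n -> agree n.+1 x y.
Proof. by move=> xy e i; rewrite ltnS leq_eqVlt => /orP[/eqP ->|/xy]. Qed.

Let decode_ext o n : exists t, agree n (decode o) (iota t).
Proof.
elim: n => [|n [t tn]]; first by have [t _] := iota_full (fun=> false); exists t.
have := decodeE o n; case: ifPn => [/asboolP [t1 [t2 [h1 h2 ne]]] dn|].
  have [e|e] := eqVneq (iota t1 n) (decode o n).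
    by exists t1; apply: agree_next.
  exists t2; apply: agree_next => //; move: ne e.
  by case: (iota t1 n) (iota t2 n) (decode o n) => [] [] [].
move=> /asboolPn nb; rewrite /forced; case: asboolP => [[t' h' e'] dn|nf dn].
  by exists t'; apply: agree_next => //; rewrite e'.
exists t; apply: agree_next => //; rewrite dn; apply/esym/negP => e.
by apply: nf; exists t.
Qed.

Let unbranched t n : ~~ branch (iota t) n -> iota t n = forced (iota t) n.
Proof.
move=> /asboolPn nb; rewrite /forced; case: asboolP => [[t' h' e']|nf].
  apply/eqP/negPn/negP => /eqP ne; apply: nb; exists t, t'; split=> //.
  by rewrite e'.
by apply/negP => e; apply: nf; exists t.
Qed.

(** By perfectness another point agrees with [iota t] up to [m], and the first place where the two
    differ is a branching level. *)
Let branch_beyond t m : exists2 n, (m <= n)%N & branch (iota t) n.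
Proof.
have [t' [ne tt']] := iota_perfect t m.
have ex : exists n, iota t n != iota t' n.
  apply: contra_notP ne => /forallNP h; apply: iota_inj.
  apply: functional_extensionality_dep => n; apply/esym/eqP.
  by have /negP := h n; rewrite negbK.
have [n ne_n min_n] := ex_minnP ex; exists n.
  by rewrite leqNgt; apply/negP => /tt' /eqP; rewrite (negPf ne_n).
apply/asboolP; exists t, t'; split=> //; last by apply/eqP.
move=> i ltin; apply/eqP/negPn/negP => /min_n; by rewrite leqNgt ltin.
Qed.

Let branch_level t k : exists n, branch (iota t) n /\ nbranch (iota t) n = k.
Proof.
have next m : exists n, branch (iota t) n /\ nbranch (iota t) n = nbranch (iota t) m.
  have [n lemn bn] := branch_beyond t m; rewrite -(subnK lemn) in bn.
  have ex : exists d, branch (iota t) (d + m)%N by exists (n - m)%N.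
  have [d bd min_d] := ex_minnP ex; exists (d + m)%N; split=> //.
  have : forall e, (e <= d)%N -> nbranch (iota t) (e + m)%N = nbranch (iota t) m.
    elim=> [//|e IHe] lted; rewrite addSn nbranchS IHe 1?ltnW//.
    case: (boolP (branch _ _)) => [/min_d|]; last by rewrite addn0.
    by rewrite leqNgt lted.
  exact.
elim: k => [|k [n [bn <-]]].
  by have := next 0%N; rewrite {2}/nbranch big_ord0.
by have := next n.+1; rewrite (nbranchS _ n) bn addn1.
Qed.

Let level t k := xget 0%N [set n | branch (iota t) n /\ nbranch (iota t) n = k].

Let levelP t k : branch (iota t) (level t k) /\ nbranch (iota t) (level t k) = k.
Proof. exact: (xgetPex 0%N (branch_level t k)). Qed.

Let levelE t n k : branch (iota t) n -> nbranch (iota t) n = k -> level t k = n.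
Proof.
move=> bn e; have [bl el] := levelP t k.
by apply: nbranch_inj bl bn _; rewrite el.
Qed.

Let encode t : cantor_space := fun k => iota t (level t k).

Let decode_encode t : decode (encode t) = iota t.
Proof.
apply: agreeP; elim=> [//|n IHn]; apply: agree_next => //.
rewrite decodeE (branch_agree IHn) (nbranch_agree IHn) (forced_agree IHn).
case: ifPn => [bn|/unbranched //].
by rewrite /encode (levelE bn erefl).
Qed.

(** The bit at level [n] is read from position [nbranch _ n], which is at most [n], so decoding
    never reads further than it writes. *)
Let decode_lip n o o' : agree n o o' -> agree n (decode o) (decode o').
Proof.
elim: n => [//|n IHn] oo'.
have /IHn {}IHn : agree n o o' by exact: agree_le oo'.
apply: agree_next => //.
rewrite !decodeE (branch_agree IHn) (nbranch_agree IHn) (forced_agree IHn).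
by case: ifP => // _; apply: oo'; rewrite ltnS nbranch_le.
Qed.

(** A closed perfect set is homeomorphic to the Cantor space: [encode] keeps only the bits at
    branching levels, the others being forced, and [decode] restores them. By [iota_full] the first
    [M] levels all branch, so the first [M] bits are unchanged. *)
Lemma cantor_coding : exists (phi : T -> cantor_space) (psi : cantor_space -> T),
  [/\ cancel phi psi, cancel psi phi, forall t, agree M (iota t) (phi t),
    forall n x y, agree n x y -> agree n (iota (psi x)) (iota (psi y))
  & forall t n, exists m, forall t',
      agree m (iota t) (iota t') -> agree n (phi t) (phi t')].
Proof.
have [psi psiE] : {psi & forall o, iota (psi o) = decode o}.
  apply: (@choice _ _ (fun o t => iota t = decode o)) => o.
  by apply: iota_closed => n; exact: decode_ext.
exists encode, psi; split.
- by move=> t; apply: iota_inj; rewrite psiE decode_encode.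
- move=> o; apply: functional_extensionality_dep => k; rewrite /encode.
  have [bl el] := levelP (psi o) k; move: bl el; rewrite psiE => bl el.
  by rewrite decodeE bl el.
- move=> t k ltkM.
  have bk i : (i < M)%N -> branch (iota t) i.
    move=> ltiM; apply/asboolP.
    have [t1 h1] := iota_full (fun j => if j == i then ~~ iota t i else iota t j).
    exists t, t1; split=> //.
      by move=> j ltji; rewrite -h1 ?(ltn_trans ltji)// ltn_eqF.
    by rewrite -h1// eqxx; case: (iota t i).
  rewrite /encode (@levelE t k)//; first exact: bk.
  rewrite /nbranch (eq_bigr (fun=> 1%N)) ?sum1_card ?card_ord// => i _.
  by rewrite bk// (ltn_trans _ ltkM).
- by move=> n x y xy; rewrite !psiE; exact: decode_lip.
- move=> t n; exists (\max_(k < n) (level t k).+1)%N => t' tt' k ltkn.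
  have ltl : ((level t k).+1 <= \max_(k < n) (level t k).+1)%N.
    exact: (leq_bigmax (Ordinal ltkn)).
  rewrite /encode (@levelE t' (level t k)); first exact: tt'.
    have [bl _] := levelP t k; rewrite -(@branch_agree _ (iota t))//.
    exact: agree_le (ltnW ltl) tt'.
  have [_ el] := levelP t k; rewrite -[RHS]el; apply: nbranch_agree.
  exact/agree_sym/(agree_le (ltnW ltl) tt').
Qed.

End CantorCoding.

(** The morphism proof is an argument of this synonym, so that a canonical structure can be attached
    to it. *)
Definition action_fun (G : groupType) (f : G -> homeo) (_ : monoid_morphism f) := f.

HB.instance Definition _ (G : groupType) (f : G -> homeo) (fM : monoid_morphism f) :=
  isUMagmaMorphism.Build G homeo (action_fun fM) fM.

Lemma action_of_fun (G : groupType) (z : G -> cantor_space -> cantor_space) :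
  (forall x, z 1%g x = x) -> (forall g h x, z (g * h)%g x = z g (z h x)) ->
  (forall g, continuous (z g)) ->
  exists zeta : Xi G, forall g x, zeta g x = z g x.
Proof.
move=> z1 zM zc.
have zK g : cancel (z g) (z g^-1%g) by move=> x; rewrite -zM mulVg z1.
have zVK g : cancel (z g^-1%g) (z g) by move=> x; rewrite -zM mulgV z1.
pose f g := Homeo (@zK g) (@zVK g) (@zc g) (@zc g^-1%g).
have fM : monoid_morphism f.
  by split=> [|g h]; apply: homeo_eq => x /=; [exact: z1|exact: zM].
by exists (action_fun fM : Xi G).
Qed.

(** * Transporting an abstract action to the Cantor space *)

Section Realization.
Variables (G : groupType) (T : Type) (I : choiceType).
Variables (b : T -> I -> bool) (e : nat -> I) (idx : I -> nat) (act : G -> T -> T).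
Variables (u : T -> cantor_space) (M : nat).

Definition bits_agree (s : seq I) (t t' : T) := forall i, i \in s -> b t i = b t' i.

Hypothesis idxK : cancel idx e.
Hypothesis b_inj : forall t t', b t =1 b t' -> t = t'.
Hypothesis b_closed : forall y : I -> bool,
  (forall s : seq I, exists t, {in s, b t =1 y}) -> exists t, b t =1 y.
Hypothesis act_cont : forall g i, exists s, forall t t',
  bits_agree s t t' -> b (act g t) i = b (act g t') i.
Hypothesis act1 : forall t, act 1%g t = t.
Hypothesis actM : forall g h t, act (g * h)%g t = act g (act h t).
Hypothesis u_cont : forall i, (i < M)%N -> exists s, forall t t',
  bits_agree s t t' -> u t i = u t' i.
Hypothesis u_full : forall x, exists t, agree M x (u t).

(** The bits of [u] are put in front of the enumerated bits [b]; the coding preserves the first [M]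
    bits, so the image of [t] starts like [u t]. *)
Let iota t : cantor_space := fun n => if (n < M)%N then u t n else b t (e (n - M)).

Let bits_agree_cat s s' t t' :
  bits_agree (s ++ s') t t' -> bits_agree s t t' /\ bits_agree s' t t'.
Proof. by move=> h; split=> i si; apply: h; rewrite mem_cat si ?orbT. Qed.

Let iota_u t : agree M (u t) (iota t).
Proof. by move=> i ltiM; rewrite /iota ltiM. Qed.

Let iota_idx t i : iota t (idx i + M)%N = b t i.
Proof. by rewrite /iota ltnNge leq_addl /= addnK idxK. Qed.

Let idx_bound (s : seq I) : exists N, forall i, i \in s -> (idx i + M < N)%N.
Proof.
elim: s => [|j s [N NP]]; first by exists 0%N.
exists (maxn N (idx j + M).+1) => i; rewrite inE => /orP[/eqP ->|/NP h].
  exact: leq_maxr.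
exact: leq_trans h (leq_maxl _ _).
Qed.

Let agree_bits_agree s : exists N, forall t t',
  agree N (iota t) (iota t') -> bits_agree s t t'.
Proof.
by have [N NP] := idx_bound s; exists N => t t' tt' i /NP /tt'; rewrite !iota_idx.
Qed.

Let bits_agree_agree n : exists s, forall t t',
  bits_agree s t t' -> agree n (iota t) (iota t').
Proof.
elim: n => [|n [s sP]]; first by exists [::].
have [s' s'P] : exists s', forall t t', bits_agree s' t t' -> iota t n = iota t' n.
  have [ltnM|leMn] := ltnP n M.
    by have [s' s'P] := u_cont ltnM; exists s' => t t' /s'P; rewrite /iota ltnM.
  exists [:: e (n - M)] => t t' h; rewrite /iota ltnNge leMn /=.
  by apply: h; rewrite inE.
exists (s ++ s') => t t' /bits_agree_cat [/sP h /s'P h'] i.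
by rewrite ltnS leq_eqVlt => /orP[/eqP->//|/h].
Qed.

Let iota_inj : injective iota.
Proof. by move=> t t' tt'; apply: b_inj => i; rewrite -!iota_idx tt'. Qed.

Let iota_closed x : (forall n, exists t, agree n x (iota t)) -> exists t, iota t = x.
Proof.
move=> xlim; have [|t bt] := b_closed (y := fun i => x (idx i + M)%N).
  move=> s; have [N NP] := idx_bound s; have [t xt] := xlim N.
  by exists t => i /NP /xt; rewrite iota_idx.
exists t; apply: functional_extensionality_dep => n.
have [s sP] := bits_agree_agree n.+1; have [N NP] := idx_bound s.
have [t' xt'] := xlim (maxn N n.+1).
rewrite (xt' n) ?leq_maxr//; apply: (sP t t') => // i /NP ltN.
by rewrite bt (xt' (idx i + M)%N) ?iota_idx// leq_max ltN.
Qed.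

Hypothesis b_perfect : forall t s, exists t', t' <> t /\ bits_agree s t t'.

(** The action [act] is conjugated by the coding of the range of [iota]. Prescribing the first [M]
    bits through [u] is what later makes the new action close to a given one. *)
Lemma realize :
  exists (zeta : Xi G) (phi : T -> cantor_space) (psi : cantor_space -> T),
  [/\ cancel phi psi, cancel psi phi /\ (forall t, agree M (u t) (phi t)),
    forall g t, phi (act g t) = zeta g (phi t),
    forall s, exists m, forall x y, agree m x y -> bits_agree s (psi x) (psi y)
  & forall t n, exists s, forall t', bits_agree s t t' -> agree n (phi t) (phi t')].
Proof.
have [||phi [psi [phiK psiK phi_u psi_cont phi_cont]]] :=
    cantor_coding (M := M) iota_inj iota_closed.
- move=> t n; have [s sP] := bits_agree_agree n.
  by have [t' [ne /sP h]] := b_perfect t s; exists t'.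
- move=> x; have [t xt] := u_full x; exists t.
  exact: agree_trans xt (@iota_u t).
have psiP s : exists m, forall x y, agree m x y -> bits_agree s (psi x) (psi y).
  by have [N NP] := agree_bits_agree s; exists N => x y /psi_cont /NP.
have phiP t n : exists s, forall t', bits_agree s t t' -> agree n (phi t) (phi t').
  have [m mP] := phi_cont t n; have [s sP] := bits_agree_agree m.
  by exists s => t' /sP /mP.
have actP g s : exists s', forall t t',
    bits_agree s' t t' -> bits_agree s (act g t) (act g t').
  elim: s => [|i s [s' s'P]]; first by exists [::].
  have [si siP] := act_cont g i; exists (s' ++ si) => t t' /bits_agree_cat[/s'P h /siP h'] j.
  by rewrite inE => /orP[/eqP ->|/h].
have [|||zeta zetaE] := @action_of_fun G (fun g x => phi (act g (psi x))).
- by move=> x; rewrite act1 psiK.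
- by move=> g h x; rewrite phiK actM.
- move=> g; apply/continuous_agreeP => x n.
  have [s sP] := phiP (act g (psi x)) n; have [s' s'P] := actP g s.
  by have [m mP] := psiP s'; exists m => y /mP /s'P /sP.
exists zeta, phi, psi; split=> //.
  by split=> // t; apply: agree_trans (phi_u t); exact: iota_u.
by move=> g t; rewrite zetaE phiK.
Qed.

End Realization.


Section RealizationProduct.
Variables (G : groupType) (T : Type) (I : choiceType).
Variables (b : T -> I -> bool) (e : nat -> I) (idx : I -> nat) (act : G -> T -> T).
Variables (u : T -> cantor_space) (M : nat).
Hypothesis idxK : cancel idx e.
Hypothesis b_inj : forall t t', b t =1 b t' -> t = t'.
Hypothesis b_closed : forall y : I -> bool,
  (forall s : seq I, exists t, {in s, b t =1 y}) -> exists t, b t =1 y.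
Hypothesis act_cont : forall g i, exists s, forall t t',
  bits_agree b s t t' -> b (act g t) i = b (act g t') i.
Hypothesis act1 : forall t, act 1%g t = t.
Hypothesis actM : forall g h t, act (g * h)%g t = act g (act h t).
Hypothesis u_cont : forall i, (i < M)%N -> exists s, forall t t',
  bits_agree b s t t' -> u t i = u t' i.
Hypothesis u_full : forall x, exists t, agree M x (u t).

(* Multiplying by a Cantor space with trivial action makes the space perfect. *)
Lemma realize_prod :
  exists (zeta : Xi G) (phi : T * cantor_space -> cantor_space)
         (psi : cantor_space -> T * cantor_space),
  [/\ cancel phi psi, cancel psi phi, forall t, agree M (u t.1) (phi t),
    forall g t, phi (act g t.1, t.2) = zeta g (phi t)
  & forall s, exists m, forall x y, agree m x y -> bits_agree b s (psi x).1 (psi y).1].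
Proof.
pose b' (t : T * cantor_space) (i : (I + nat)%type) :=
  match i with inl i => b t.1 i | inr n => t.2 n end.
pose e' n : (I + nat)%type := if odd n then inr n./2 else inl (e n./2).
pose idx' (i : (I + nat)%type) :=
  match i with inl i => (idx i).*2 | inr n => n.*2.+1 end.
have lift_bits_agree s : exists s', forall t t',
    bits_agree b' s' t t' -> bits_agree b s t.1 t'.1.
  by exists [seq inl i | i <- s] => t t' h i si; apply: (h (inl i)); apply: map_f.
have [|||||||||zeta [phi [psi [phiK [psiK phi_u] zetaE psiP _]]]] :=
  @realize G _ _ b' e' idx' (fun g t => (act g t.1, t.2)) (fun t => u t.1) M.
- by case=> [i|n] /=; rewrite /e' /= odd_double /= ?uphalf_double ?doubleK ?idxK.
- move=> [t w] [t' w'] tt'; congr pair; first by apply: b_inj => i; exact: (tt' (inl i)).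
  by apply: functional_extensionality_dep => n; exact: (tt' (inr n)).
- move=> y yP; have [|t bt] := b_closed (y := fun i => y (inl i)).
    move=> s; have [t tP] := yP [seq inl i | i <- s]; exists t.1 => i si.
    by apply: (tP (inl i)); exact: map_f.
  by exists (t, fun n => y (inr n)) => -[i|n] /=.
- move=> g [i|n]; last by exists [:: inr n] => t t' /(_ (inr n)); rewrite inE; exact.
  have [s sP] := act_cont g i; have [s' s'P] := lift_bits_agree s.
  by exists s' => t t' /s'P /sP.
- by move=> [t w] /=; rewrite act1.
- by move=> g h [t w] /=; rewrite actM.
- move=> i /u_cont [s sP]; have [s' s'P] := lift_bits_agree s.
  by exists s' => t t' /s'P /sP.
- by move=> x; have [t xt] := u_full x; exists (t, x).
- move=> [t w] s.
  have [N NP] : exists N, forall n, inr n \in s -> (n < N)%N.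
    elim: s => [|[i|m] s [N NP]]; first by exists 0%N.
      by exists N => n; rewrite inE => /orP[/eqP//|/NP].
    exists (maxn N m.+1) => n; rewrite inE leq_max => /orP[/eqP[->]|/NP ->//].
    by rewrite ltnSn orbT.
  (* [N] exceeds every index of the extra factor that occurs in [s], so flipping this bit is
     invisible to [s]. *)
  exists (t, fun n => if n == N then ~~ w N else w n); split=> [[]|].
    by move/(congr1 (fun f : cantor_space => f N)); rewrite eqxx; case: (w N).
  by move=> [i|n] //= /NP ltnN; rewrite ltn_eqF.
exists zeta, phi, psi; split=> // s.
have [s' s'P] := lift_bits_agree s; have [m mP] := psiP s'.
by exists m => x y /mP /s'P.
Qed.

End RealizationProduct.

(** * Patterns and the category argument *)

Definition patterns (G : groupType) (zeta : Xi G) (A : cantor_space -> bool)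
    (K : seq G) : set (seq bool) :=
  [set [seq A (zeta k x) | k <- K] | x in [set: cantor_space]].

Definition head_bit (x : cantor_space) : bool := x 0%N.

(* Clopen sets are coded in a countable type, so that they can be enumerated. *)
Definition clopen_of (c : nat * seq (seq bool)) (x : cantor_space) : bool :=
  mkseq x c.1 \in c.2.

(** By uniform continuity the first bit of [f y] depends on a prefix of [y] of fixed length [m]; the
    code lists the accepted prefixes, tested on their extensions by [false]. *)
Lemma head_bit_clopen (f : homeo) :
  exists c, forall y, head_bit (f y) = clopen_of c y.
Proof.
have [m mP] := continuous_agree_unif 1 (@homeo_fun_continuous f).
pose ext (s : seq bool) : cantor_space := fun i => nth false s i.
exists (m, [seq val t | t : m.-tuple bool <- enum {: m.-tuple bool}
                      & head_bit (f (ext (val t)))]).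
move=> y; rewrite /clopen_of /=.
have fy : head_bit (f y) = head_bit (f (ext (mkseq y m))).
  by apply: mP => // i ltim; rewrite /ext nth_mkseq.
have szy : size (mkseq y m) == m by rewrite size_mkseq.
rewrite fy; apply/idP/mapP => [fyt|[t]].
  by exists (Tuple szy) => //; rewrite mem_filter fyt mem_enum.
by rewrite mem_filter => /andP[ft _] ->.
Qed.

Section Category.
Variable G : groupType.
Implicit Types (zeta eta xi : Xi G) (F K : seq G) (N : nat).

Lemma action_nbhs_sub zeta zeta' F F' N N' :
  action_nbhs zeta F N zeta' -> {subset F <= F'} -> (N <= N')%N ->
  action_nbhs zeta' F' N' `<=` action_nbhs zeta F N.
Proof.
move=> zz' sF leN eta ez' g gF x.
apply: agree_trans (zz' g gF x) (agree_le leN _).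
exact: ez' (sF _ gF) x.
Qed.

Lemma patterns_action_nbhs zeta eta F N K : action_nbhs zeta F N eta ->
  {subset K <= F} -> (0 < N)%N ->
  patterns eta head_bit K = patterns zeta head_bit K.
Proof.
move=> ze sK N0; rewrite /patterns; congr image; apply: functional_extensionality_dep => x.
by apply/eq_in_map => k /sK kF; rewrite /head_bit (ze k kF x).
Qed.

(** Conjugation by [f] reparametrizes the points and replaces [head_bit] by its preimage under
    [f]. *)
Lemma patterns_conj (f : homeo) xi c K :
  (forall y, head_bit (f y) = clopen_of c y) ->
  patterns (conj_action f xi) head_bit K = patterns xi (clopen_of c) K.
Proof.
move=> fc; apply/seteqP; split=> _ [x _ <-].
  by exists (homeo_inv f x) => //; apply: eq_map => k; rewrite -fc.
exists (f x) => //; apply: eq_map => k; rewrite -fc /=.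
by rewrite homeo_funK.
Qed.

(** Completeness of [Xi G] in concrete form: from stage [n] on, the first [N n] bits of the values
    at elements of [F n] are frozen, and the limit reads each bit after it is frozen. *)
Lemma action_nbhs_limit (z : nat -> Xi G) (F : nat -> seq G) (N : nat -> nat) :
  (forall n, action_nbhs (z n) (F n) (N n) (z n.+1)) ->
  (forall n, {subset F n <= F n.+1}) -> (forall n, (N n <= N n.+1)%N) ->
  (forall g k, exists n, g \in F n /\ (k <= N n)%N) ->
  exists eta, forall n, action_nbhs (z n) (F n) (N n) eta.
Proof.
move=> zS FS NS exh.
have Vm n d : action_nbhs (z n) (F n) (N n) `<=` action_nbhs (z n) (F n) (N n) /\
    action_nbhs (z n) (F n) (N n) (z (d + n)%N).
  split=> //; suff : action_nbhs (z (d + n)%N) (F (d + n)%N) (N (d + n)%N) `<=`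
      action_nbhs (z n) (F n) (N n).
    exact.
  elim: d => [//|d IHd]; apply: subset_trans IHd.
  exact: action_nbhs_sub (zS _) (FS _) (NS _).
have {}Vm n m : (n <= m)%N -> action_nbhs (z n) (F n) (N n) (z m).
  by move=> /subnK <-; have [] := Vm n (m - n)%N.
have [lv lvP] : {lv : G * nat -> nat & forall p, p.1 \in F (lv p) /\ (p.2 <= N (lv p))%N}.
  by apply: (@choice _ _ (fun p n => p.1 \in F n /\ (p.2 <= N n)%N)) => -[g k]; exact: exh.
pose h g x : cantor_space := fun i => z (lv (g, i.+1)) g x i.
have hz n g : g \in F n -> forall x, agree (N n) (z n g x) (h g x).
  move=> gn x i ltin; have [gl ltil] := lvP (g, i.+1).
  rewrite (Vm _ (maxn n (lv (g, i.+1))) (leq_maxl _ _) _ gn x)//.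
  by rewrite /h (Vm _ (maxn n (lv (g, i.+1))) (leq_maxr _ _) _ gl x).
have happ g k : exists n, forall m, (n <= m)%N -> forall x, agree k (h g x) (z m g x).
  have [n [gn ltkn]] := exh g k; exists n => m lenm x.
  apply: agree_trans (agree_le ltkn (agree_sym (hz _ _ gn x))) _.
  exact: agree_le ltkn (Vm _ _ lenm _ gn x).
have [|||eta etaE] := @action_of_fun G h.
- move=> x; apply: agreeP => k; have [n nP] := happ 1%g k.
  by apply: agree_trans (nP n (leqnn n) x) _; rewrite gmulf1.
- move=> g g' x; apply: agreeP => k.
  have [n1 P1] := happ g k.
  (* The modulus [l] is taken at the fixed stage [n1], before the later stage [m] is chosen, so no
     equicontinuity of the [z n] is required. *)
  have [l lP] := continuous_agree_unif k (@homeo_fun_continuous (z n1 g)).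
  have [n2 P2] := happ g' l; have [n3 P3] := happ (g * g')%g k.
  pose m := maxn n1 (maxn n2 n3).
  have le1 : (n1 <= m)%N by rewrite leq_max leqnn.
  have le2 : (n2 <= m)%N by rewrite !leq_max leqnn orbT.
  have le3 : (n3 <= m)%N by rewrite !leq_max leqnn !orbT.
  apply: agree_trans (P3 m le3 x) _; rewrite gmulfM /=.
  apply: agree_trans (agree_sym (P1 m le1 _)) _.
  apply: agree_trans (P1 n1 (leqnn _) _) _.
  apply: agree_trans (agree_sym (P1 n1 (leqnn _) _)).
  by apply: lP; apply: agree_sym; exact: P2.
- move=> g; apply/continuous_agreeP => x k; have [n nP] := happ g k.
  have [m mP] := continuous_agree_unif k (@homeo_fun_continuous (z n g)).
  exists m => y /mP xy; apply: agree_trans (nP n (leqnn n) x) _.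
  by apply: agree_trans xy (agree_sym (nP n (leqnn n) y)).
by exists eta => n g gn x; rewrite etaE; exact: hz.
Qed.

End Category.

Lemma countable_enum (T : choiceType) (x0 : T) : countable [set: T] ->
  exists (e : nat -> T) (idx : T -> nat), cancel idx e.
Proof.
move=> /countable_injP [f finj].
exists (fun n => xget x0 [set t | f t = n]), f => t.
apply: finj; rewrite ?inE//.
exact: (@xgetPex _ x0 [set t' | f t' = f t] (ex_intro _ t erefl)).
Qed.

(** The negation of the rigidity that a comeager class would force: finite precision data refining
    [F0] and [N0] never determine the patterns of the actions in [M]. *)
Definition nowhere_rigid (G : groupType) (M : set (Xi G)) (z0 : Xi G) F0 N0 :=
  forall zeta F N, M zeta -> action_nbhs z0 F0 N0 zeta ->
  {subset F0 <= F} -> (N0 <= N)%N ->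
  exists zeta1 zeta2, [/\ M zeta1 /\ M zeta2, action_nbhs zeta F N zeta1,
    action_nbhs zeta F N zeta2
    & exists K, patterns zeta1 head_bit K <> patterns zeta2 head_bit K].

(* [M] is a G_delta set, the intersection of the sets [C n], and [D n] are
   relatively open and dense in [M]. *)
Lemma no_generic_class (G : groupType) (M : set (Xi G)) (C D : nat -> set (Xi G))
    (e : nat -> G) (idx : G -> nat) (xi z0 : Xi G) (F0 : seq G) (N0 : nat) :
  cancel idx e -> M z0 -> nowhere_rigid M z0 F0 N0 ->
  (forall n zeta, M zeta -> exists F N, action_nbhs zeta F N `<=` C n) ->
  (forall eta, (forall n, C n eta) -> M eta) ->
  (forall n zeta F N, M zeta -> exists zeta' F' N',
     [/\ M zeta', action_nbhs zeta F N zeta' & M `&` action_nbhs zeta' F' N' `<=` D n]) ->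
  (forall eta, M eta -> (forall n, D n eta) -> conjugacy_class xi eta) -> False.
Proof.
move=> idxK Mz0 rigid CM MC Dd Dcl.
(* Every code of a clopen set has an index; indices that decode to nothing stand for the empty
   set. *)
pose code n : nat * seq (seq bool) := odflt (0%N, [::]) (unpickle n).
pose ok (p : Xi G * seq G * nat) :=
  [/\ M p.1.1, action_nbhs z0 F0 N0 p.1.1, {subset F0 <= p.1.2} & (N0 <= p.2)%N].
pose V (p : Xi G * seq G * nat) := action_nbhs p.1.1 p.1.2 p.2.
(* Stage [n] enters [C n] and [D n] and diagonalizes against the [n]-th clopen set. Including [e n]
   and precision [n] makes the stages exhaust [G] and converge. *)
pose good n (p q : Xi G * seq G * nat) :=
  [/\ ok q, V p q.1.1, {subset p.1.2 <= q.1.2}, (p.2 <= q.2)%N &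
  [/\ e n \in q.1.2, (n <= q.2)%N, V q `<=` C n, M `&` V q `<=` D n
    & exists K, {subset K <= q.1.2} /\ (0 < q.2)%N /\
       patterns q.1.1 head_bit K <> patterns xi (clopen_of (code n)) K]].
have step n p : ok p -> exists q, good n p q.
  case: p => [[z F] N] [/= Mz zz0 sF leN].
  have [K [za [Mza zza neK]]] : exists K za, [/\ M za, action_nbhs z F N za &
      patterns za head_bit K <> patterns xi (clopen_of (code n)) K].
    have [z1 [z2 [[M1 M2] V1 V2 [K ne]]]] := rigid z F N Mz zz0 sF leN.
    (* As [z1] and [z2] have different patterns, at most one of them can match [xi] along the [n]-th
       clopen set. *)
    have [e1|e1] := pselect (patterns z1 head_bit K = patterns xi (clopen_of (code n)) K).
      by exists K, z2; split=> // e2; apply: ne; rewrite e1.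
    by exists K, z1.
  (* With [K] included and positive precision [N.+1], all later refinements keep the patterns of
     [za] on [K]. *)
  have [zb [Fb [Nb [Mzb zzb Db]]]] := Dd n za (F ++ K) N.+1 Mza.
  have [Fc [Nc Cc]] := CM n zb Mzb.
  pose F' := F ++ K ++ Fb ++ Fc ++ [:: e n].
  pose N' := maxn N.+1 (maxn Nb (maxn Nc n)).
  have leN' : (N.+1 <= N')%N by rewrite leq_max leqnn.
  have zzb' : action_nbhs z F N zb.
    apply: (action_nbhs_sub zza _ _ zzb) => //.
    by move=> g gF; rewrite mem_cat gF.
  exists (zb, F', N'); split=> /=; first split=> //=.
  - exact: (action_nbhs_sub zz0 sF leN zzb').
  - by move=> g /sF gF; rewrite mem_cat gF.
  - exact: leq_trans leN (ltnW leN').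
  - exact: zzb'.
  - by move=> g gF; rewrite mem_cat gF.
  - exact: ltnW leN'.
  split=> /=.
  - by rewrite !mem_cat inE eqxx !orbT.
  - by rewrite !leq_max leqnn !orbT.
  - apply: subset_trans Cc; apply: (@action_nbhs_sub _ zb zb Fc F' Nc N') => //.
      by move=> g gF; rewrite !mem_cat gF !orbT.
    by rewrite !leq_max leqnn !orbT.
  - apply: subset_trans Db; apply: setIS; apply: (@action_nbhs_sub _ zb zb Fb F' Nb N') => //.
      by move=> g gF; rewrite !mem_cat gF !orbT.
    by rewrite !leq_max leqnn !orbT.
  - exists K; split; last split.
    + by move=> g gF; rewrite !mem_cat gF !orbT.
    + exact: leq_trans leN'.
    + rewrite (@patterns_action_nbhs _ za _ (F ++ K) N.+1)//.
      by move=> g gF; rewrite !mem_cat gF !orbT.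
have [next nextP] : {next : nat * (Xi G * seq G * nat) -> Xi G * seq G * nat &
    forall p, ok p.2 -> good p.1 p.2 (next p)}.
  apply: (@choice _ _ (fun p q => ok p.2 -> good p.1 p.2 q)) => -[n p].
  have [/= okp|] := pselect (ok p); last by exists p.
  by have [q qP] := step n p okp; exists q.
pose s := fix s n := if n is m.+1 then next (m, s m) else (z0, F0, N0).
have oks n : ok (s n).
  elim: n => [|n IHn]; first by split.
  by have [] := nextP (n, s n) IHn.
have goods n : good n (s n) (s n.+1) by exact: nextP (n, s n) (oks n).
have FS m n : (m <= n)%N -> {subset (s m).1.2 <= (s n).1.2} /\ ((s m).2 <= (s n).2)%N.
  move=> /subnK <-; elim: (n - m)%N => [|d [IH IH']]; first by split.
  have [_ _ sF leN _] := goods (d + m)%N; rewrite addSn.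
  by split=> [g /IH /sF //|]; exact: leq_trans IH' leN.
have [||||eta etaV] :=
  @action_nbhs_limit G (fun n => (s n).1.1) (fun n => (s n).1.2) (fun n => (s n).2).
- by move=> n; have [] := goods n.
- by move=> n; have [] := goods n.
- by move=> n; have [] := goods n.
- move=> g k; exists (maxn (idx g) k).+1; split.
    have [sF _] := FS (idx g).+1 (maxn (idx g) k).+1 (leq_maxl _ _).
    by apply: sF; have [_ _ _ _ [+ _ _ _ _]] := goods (idx g); rewrite idxK.
  have [_ leN] := FS k.+1 (maxn (idx g) k).+1 (leq_maxr _ _).
  by apply: leq_trans leN; have [_ _ _ _ [_ + _ _ _]] := goods k.
have Meta : M eta.
  by apply: MC => n; have [_ _ _ _ [_ _ CV _ _]] := goods n; exact: CV (etaV n.+1).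
have [f _ feta] : conjugacy_class xi eta.
  apply: Dcl => // n; have [_ _ _ _ [_ _ _ DV _]] := goods n.
  by apply: DV; split=> //; exact: etaV n.+1.
(* The stage whose index codes the preimage of [head_bit] under [f] rules out [f] as a conjugating
   homeomorphism. *)
have [c cP] := head_bit_clopen f; pose n := pickle c.
have [_ _ _ _ [_ _ _ _ [K [KF [N1 ne]]]]] := goods n.
apply: ne; rewrite /code pickleK /= -(patterns_conj xi K cP) feta.
by rewrite (patterns_action_nbhs (etaV n.+1)).
Qed.

Lemma no_comeager_class (G : groupType) (xi z0 : Xi G) F0 N0 :
  countable [set: G] -> nowhere_rigid setT z0 F0 N0 ->
  ~ comeager (conjugacy_class xi).
Proof.
move=> Gc rigid [_ [D oD ->] Dcl].
have [e [idx idxK]] := countable_enum 1%g Gc.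
apply: (@no_generic_class G setT (fun=> setT) D e idx xi z0 F0 N0) => //.
- by move=> n zeta _; exists [::], 0%N.
- move=> n zeta F N _; have [oDn dDn] := oD n.
  have [|zeta' [zeta'V zeta'D]] := dDn _ _ (@open_interior _ (action_nbhs zeta F N)).
    by exists zeta; exact: nbhs_action_nbhs.
  have [F' [N' V'D]] := nbhs_action_nbhsP (open_nbhs_nbhs (conj oDn zeta'D)).
  exists zeta', F', N'; split=> //; first exact: interior_subset.
  by rewrite setTI.
- by move=> eta _ etaD; apply: Dcl => n _; exact: etaD.
Qed.

(** Minimality means that every orbit meets every cylinder, and [C n] asks this for cylinders of
    length [n]. For a minimal action, compactness yields finitely many group elements that suffice
    for all points, so [C n] contains a neighbourhood of it. *)
Lemma minimal_Gdelta (G : groupType) (e : nat -> G) (idx : G -> nat) : cancel idx e ->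
  exists C : nat -> set (Xi G),
  (forall n zeta, minimal_action zeta -> exists F N, action_nbhs zeta F N `<=` C n) /\
  (forall eta, (forall n, C n eta) -> minimal_action eta).
Proof.
move=> idxK.
exists (fun n => [set eta : Xi G | forall x y, exists g, agree n y (eta g x)]); split.
  move=> n zeta zmin.
  pose P m x := forall t : n.-tuple bool, exists2 k, (k < m)%N &
    agree n (fun i => nth false t i) (zeta (e k) x).
  have [k m x lekm Pk t|x|m mP] := @cantor_compactness P.
  - by have [i ltik h] := Pk t; exists i => //; exact: leq_trans lekm.
  - have loc (t : n.-tuple bool) : exists km : nat * nat, forall x', agree km.2 x x' ->
        agree n (fun i => nth false t i) (zeta (e km.1) x').
      pose y : cantor_space := fun i => nth false t i.
      have [g gx] : exists g, agree n y (zeta g x).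
        pose A : set cantor_space := closure (range (fun g => zeta g x)).
        have AT : A = setT.
          apply: zmin; first exact: closed_closure.
            by exists (zeta 1%g x); apply: subset_closure; exists 1%g.
          move=> g x' Ax' U /(@homeo_fun_continuous (zeta g)) /Ax' [_ [[h _ <-] Uh]].
          by exists (zeta (g * h)%g x); split; [exists (g * h)%g|rewrite gmulfM].
        have Ay : A y by rewrite AT.
        by have [_ [[g _ <-] gy]] := Ay _ (nbhs_agree n y); exists g.
      have /continuous_agreeP/(_ x n) [m mP] := @homeo_fun_continuous (zeta g).
      exists (idx g, m) => x' /= /mP xx'; rewrite idxK.
      exact: agree_trans gx xx'.
    have [km kmP] := @choice _ _ _ loc.
    exists (\max_(t : n.-tuple bool) maxn (km t).1.+1 (km t).2)%N => x' xx' t.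
    have le_t := @leq_bigmax _ (fun t => maxn (km t).1.+1 (km t).2) t.
    exists (km t).1; first exact: leq_trans (leq_maxl _ _) le_t.
    by apply: kmP; apply: agree_le xx'; exact: leq_trans (leq_maxr _ _) le_t.
  exists [seq e k | k <- iota 0 m], n => eta etaV x y.
  have szy : size (mkseq y n) == n by rewrite size_mkseq.
  have [k ltkm h] := mP x (Tuple szy); exists (e k).
  apply: agree_trans (etaV (e k) _ x); last by apply: map_f; rewrite mem_iota.
  by apply: agree_trans h => i ltin /=; rewrite nth_mkseq.
move=> eta etaP A cA [x Ax] Ainv; apply/seteqP; split=> // y _.
apply: cA => U /nbhs_agreeP [n nU]; have [g gy] := etaP n x y.
by exists (eta g x); split; [exact: Ainv|exact: nU].
Qed.

Lemma no_comeager_class_min (G : groupType) (xi : Xi_min G) F0 N0 :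
  countable [set: G] -> nowhere_rigid (Xi_min G) (set_val xi) F0 N0 ->
  ~ comeager (conjugacy_class_min xi).
Proof.
move=> Gc rigid [_ [D oD ->] Dcl].
have [e [idx idxK]] := countable_enum 1%g Gc.
have [C [CM MC]] := minimal_Gdelta idxK.
have in_min (eta : Xi G) : minimal_action eta ->
    exists eta' : Xi_min G, set_val eta' = eta.
  by move=> meta; exists (exist _ eta (mem_set meta)).
apply: (@no_generic_class G (Xi_min G) C (fun n => set_val @` D n) e idx
  (set_val xi) (set_val xi) F0 N0) => //.
- exact: set_valP.
- move=> n zeta F N mzeta; have [oDn dDn] := oD n.
  have [zeta1 zeta1E] := in_min _ mzeta.
  have [||zeta' [zeta'V zeta'D]] := dDn (set_val @^-1` (action_nbhs zeta F N)°).
  - by exists zeta1; rewrite /= zeta1E; exact: nbhs_action_nbhs.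
  - by exists (action_nbhs zeta F N)° => //; exact: open_interior.
  have [U oU UD] : exists2 U : set (Xi G), open U & set_val @^-1` U = D n by exact: oDn.
  have Uz : U (set_val zeta') by rewrite -[U _]/((set_val @^-1` U) zeta') UD.
  have [F' [N' V'U]] := nbhs_action_nbhsP (open_nbhs_nbhs (conj oU Uz)).
  exists (set_val zeta'), F', N'; split; [exact: set_valP|exact: interior_subset|].
  move=> eta [/in_min [eta' <-] /V'U Ueta].
  by exists eta' => //; rewrite -UD.
- move=> eta /in_min [eta' <-] etaD; apply: (Dcl eta') => n _.
  have [eta1 D1 e1] := etaD n.
  by have <- : eta1 = eta' by exact: val_inj.
Qed.

(** * Locally finite groups *)

Section Subgroups.
Variable G : groupType.

Lemma subgroup_smallest (S : set G) : subgroup (smallest (@subgroup G) S).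
Proof.
split=> [H [[H1 _ _] _] //|x y Sx Sy H HP|x Sx H HP].
  by have [[_ HM _] _] := HP; apply: HM; [exact: Sx|exact: Sy].
by have [[_ _ HV] _] := HP; apply: HV; exact: Sx.
Qed.

(** [p g] is the quotient of [g] by a chosen representative of its coset [H g]; choosing [1] in [H]
    itself makes [p] fix [H] pointwise. *)
Lemma subgroup_retraction (H : set G) : subgroup H ->
  exists p : G -> G, [/\ forall g, H (p g),
    forall h g, H h -> p (h * g)%g = (h * p g)%g & forall g, H g -> p g = g].
Proof.
move=> [H1 HM HV].
pose coset g := [set r : G | H (g * r^-1)%g].
have cosetM h g : H h -> coset (h * g)%g = coset g.
  move=> Hh; apply/seteqP; split=> r; rewrite /coset /= => Hr.
    by rewrite -[g](mulKg h) -mulgA; apply: HM; [exact: HV|].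
  by rewrite -mulgA; exact: HM.
pose rep g := if `[< H g >] then 1%g else xget 1%g (coset g).
have repP g : H (g * (rep g)^-1)%g.
  rewrite /rep; case: asboolP => [Hg|_]; first by rewrite invg1 mulg1.
  by apply: (@xgetPex _ 1%g (coset g)); exists g; rewrite /coset /= mulgV.
have repM h g : H h -> rep (h * g)%g = rep g.
  move=> Hh; rewrite /rep cosetM//; congr (if _ then _ else _).
  apply: asbool_equiv_eq; split=> [Hhg|Hg]; last exact: HM.
  by rewrite -[g](mulKg h); apply: HM => //; exact: HV.
exists (fun g => g * (rep g)^-1)%g; split=> [//|h g Hh|g Hg].
  by rewrite repM// mulgA.
by rewrite /rep asboolT// invg1 mulg1.
Qed.

Lemma locally_finite_subgroup (F : seq G) : locally_finite G ->
  exists H, [/\ subgroup H, finite_set H & forall g, g \in F -> H g].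
Proof.
move=> lf; exists (smallest (@subgroup G) [set` F]); split.
- exact: subgroup_smallest.
- by apply: lf; exists [set` F] => //; exact: finite_seq.
- by move=> g gF; exact: sub_gen_smallest.
Qed.

Lemma finite_set_seq (H : set G) : finite_set H ->
  exists s : seq G, uniq s /\ forall g, g \in s <-> H g.
Proof.
move=> /finite_seqP [s Hs]; exists (undup s); split; first exact: undup_uniq.
by move=> g; rewrite mem_undup Hs.
Qed.

Lemma not_fg_infinite : ~ finitely_generated [set: G] ->
  forall s : seq G, exists g, g \notin s.
Proof.
move=> nfg s; apply: contra_notP nfg => /forallNP h; exists [set` s].
  exact: finite_seq.
apply/seteqP; split=> // g _; apply: sub_gen_smallest => /=.
by have /negP := h g; rewrite negbK.
Qed.

End Subgroups.

(** * Minimal actions on inverse limits of finite subgroups *)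

Section Tower.
Variables (G : groupType) (e : nat -> G) (idx : G -> nat).
Hypothesis idxK : cancel idx e.
Variable K : nat -> set G.
Hypothesis Ksub : forall n, subgroup (K n).
Hypothesis Kfin : forall n, finite_set (K n).
Hypothesis KS : forall n, K n `<=` K n.+1.
Hypothesis Kexh : forall g, exists n, K n g.
Hypothesis Kinf : forall n, exists m g, K m g /\ ~ K n g.

Let K1 n : K n 1%g. Proof. by have [] := Ksub n. Qed.
Let KM n g h : K n g -> K n h -> K n (g * h)%g. Proof. have [_ + _] := Ksub n; exact. Qed.
Let KV n g : K n g -> K n g^-1%g. Proof. have [_ _ +] := Ksub n; exact. Qed.
Let Kle m n : (m <= n)%N -> K m `<=` K n.
Proof.
move=> /subnK <-; elim: (n - m)%N => [//|d IHd].
by apply: subset_trans IHd _; exact: KS.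
Qed.

Variable p : nat -> G -> G.
Hypothesis pP : forall n, [/\ forall g, K n (p n g),
    forall h g, K n h -> p n (h * g)%g = (h * p n g)%g & forall g, K n g -> p n g = g].

(* The inverse limit of the finite sets [K n] along the maps [p n], where a
   thread [t] is recorded through the threads [g * t] of its whole orbit. *)
Definition is_thread (y : nat -> G -> G) : Prop :=
  [/\ forall n g, K n (y n g), forall n h g, K n h -> y n (h * g)%g = (h * y n g)%g
    & forall n g, p n (y n.+1 g) = y n g].

Definition thread := {y : nat -> G -> G | is_thread y}.

Fixpoint descend n d g := if d is d'.+1 then p n (descend n.+1 d' g) else p n g.

(** At level [n], the element [g] is pushed down by the maps [p] from a level whose subgroup
    contains it; starting higher changes nothing, because each [p m] fixes [K m]. *)
Lemma thread_exists : exists y, is_thread y.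
Proof.
have [pK pM pid] : [/\ forall n g, K n (p n g),
    forall n h g, K n h -> p n (h * g)%g = (h * p n g)%g & forall n g, K n g -> p n g = g].
  by split=> n; have [] := pP n.
have descM d n h g : K n h -> descend n d (h * g)%g = (h * descend n d g)%g.
  elim: d n => [|d IHd] n Kh /=; first exact: pM.
  by rewrite IHd ?pM//; exact: KS.
have descS d n g : K (d + n)%N g -> descend n d.+1 g = descend n d g.
  elim: d n => [|d IHd] n Kg /=; first by rewrite (pid n.+1)//; exact: KS.
  by congr (p n _); apply: (IHd n.+1); rewrite addnS.
have [lev levP] : {lev : G -> nat & forall g, K (lev g) g}.
  by apply: (@choice _ _ (fun g n => K n g)); exact: Kexh.
have desc_lev n g d : (lev g <= d)%N -> descend n d g = descend n (lev g) g.
  move=> /subnK <-; elim: (d - _)%N => [//|k IHk].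
  rewrite addSn descS//; apply: Kle (levP g).
  by rewrite -addnA addnC -addnA leq_addr.
exists (fun n g => descend n (lev g) g); split=> [n g|n h g Kh|n g].
- rewrite /=; case: (lev g) => [|d] /=; exact: pK.
- by rewrite -(desc_lev _ _ _ (leq_maxl _ (lev g))) descM// desc_lev// leq_maxr.
- by rewrite -[LHS]/(descend n (lev g).+1 g) desc_lev.
Qed.


Definition thread_bit (t : thread) (i : nat * G * G) : bool :=
  sval t i.1.1 i.1.2 == i.2.

Lemma thread_eq (t t' : thread) : (forall n g, sval t n g = sval t' n g) -> t = t'.
Proof.
case: t t' => [y yT] [y' yT'] /= yy'; apply: eq_exist.
by apply: functional_extensionality_dep => n; apply: functional_extensionality_dep.
Qed.

Lemma thread_bit_inj t t' : thread_bit t =1 thread_bit t' -> t = t'.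
Proof.
move=> tt'; apply: thread_eq => n g.
by apply/eqP; have := tt' (n, g, sval t' n g); rewrite /thread_bit /= eqxx.
Qed.

(** As [K n] is finite, finitely many bits determine the value of a thread at [(n, g)]. *)
Lemma bits_agree_thread (L : seq (nat * G)) : exists s, forall t t',
  bits_agree thread_bit s t t' -> forall n g, (n, g) \in L -> sval t n g = sval t' n g.
Proof.
elim: L => [|[n g] L [s sP]]; first by exists [::].
have [ks [_ ksP]] := finite_set_seq (Kfin n).
exists ([seq (n, g, k) | k <- ks] ++ s) => t t' tt' m h.
rewrite inE => /orP[/eqP[-> ->]|mL]; last first.
  by apply: sP mL => i si; apply: tt'; rewrite mem_cat si orbT.
have [tK _ _] := svalP t'.
have /tt' : (n, g, sval t' n g) \in [seq (n, g, k) | k <- ks] ++ s.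
  by rewrite mem_cat map_f//; apply/ksP.
by rewrite /thread_bit /= eqxx => /eqP.
Qed.

Lemma thread_bits_agree s : exists L : seq (nat * G), forall t t',
  (forall n g, (n, g) \in L -> sval t n g = sval t' n g) -> bits_agree thread_bit s t t'.
Proof.
exists [seq i.1 | i <- s] => t t' tt' [[n g] k] si; rewrite /thread_bit /= tt'//.
by apply/mapP; exists (n, g, k).
Qed.

Lemma thread_bit_closed (Y : nat * G * G -> bool) :
  (forall s : seq (nat * G * G), exists t, {in s, thread_bit t =1 Y}) ->
  exists t, thread_bit t =1 Y.
Proof.
move=> Ylim.
have Yuniq n g k k' : Y (n, g, k) -> Y (n, g, k') -> k = k'.
  have [t tY] := Ylim [:: (n, g, k); (n, g, k')].
  rewrite -!tY ?inE ?eqxx ?orbT// /thread_bit /=.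
  by move=> /eqP <- /eqP <-.
have Yex n g : exists k, Y (n, g, k).
  have [ks [_ ksP]] := finite_set_seq (Kfin n).
  have [t tY] := Ylim [seq (n, g, k) | k <- ks]; exists (sval t n g).
  rewrite -tY /thread_bit /=; first exact: eqxx.
  by apply: map_f; apply/ksP; have [] := svalP t.
have [y yY] : {y : nat * G -> G & forall i, Y (i.1, i.2, y i)}.
  by apply: (@choice _ _ (fun i k => Y (i.1, i.2, k))) => -[n g]; exact: Yex.
have yt (L : seq (nat * G)) : exists t : thread,
    forall n g, (n, g) \in L -> sval t n g = y (n, g).
  have [t tY] := Ylim [seq (i.1, i.2, y i) | i <- L]; exists t => n g ngL.
  apply/eqP; rewrite -[_ == _]/(thread_bit t (n, g, y (n, g))) tY; first exact: (yY (n, g)).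
  by apply/mapP; exists (n, g).
have yT : is_thread (fun n g => y (n, g)).
  split=> [n g|n h g Kh|n g].
  - have [t tP] := yt [:: (n, g)]; rewrite -tP ?inE//.
    by have [] := svalP t.
  - have [t tP] := yt [:: (n, h * g)%g; (n, g)]; rewrite -!tP ?inE ?eqxx ?orbT//.
    by have [_ + _] := svalP t; apply.
  - have [t tP] := yt [:: (n.+1, g); (n, g)]; rewrite -!tP ?inE ?eqxx ?orbT//.
    by have [_ _ +] := svalP t; apply.
exists (exist _ _ yT) => -[[n g] k]; rewrite /thread_bit /=.
apply/eqP/idP => [<-|]; first exact: (yY (n, g)).
exact: Yuniq (yY (n, g)).
Qed.

Lemma shift_is_thread k (t : thread) : is_thread (fun n g => sval t n (g * k)%g).
Proof.
have [tK tM tp] := svalP t; split=> [n g|n h g Kh|n g] //.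
by rewrite -(mulgA h g k) (tM _ _ _ Kh).
Qed.

Definition thread_act k (t : thread) : thread := exist _ _ (shift_is_thread k t).

(** One value at a high level determines finitely many others: equivariance gives the values at the
    elements of that level's subgroup, and the maps [p n] give the lower levels. *)
Lemma thread_det (L : seq (nat * G)) : exists N, forall t t' : thread,
  sval t N 1%g = sval t' N 1%g ->
  forall n g, (n, g) \in L -> sval t n g = sval t' n g.
Proof.
have below (t t' : thread) d n g : sval t (d + n)%N g = sval t' (d + n)%N g ->
    sval t n g = sval t' n g.
  elim: d => [//|d IHd] h; apply: IHd.
  have [_ _ tp] := svalP t; have [_ _ tp'] := svalP t'.
  by rewrite -tp -tp' -addSn h.
elim: L => [|[n g] L [N NP]]; first by exists 0%N.
have [m Km] := Kexh g; exists (maxn N (maxn m n)) => t t' tt' n' g'.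
have le0 : (N <= maxn N (maxn m n))%N by rewrite leq_max leqnn.
have le1 : (m <= maxn N (maxn m n))%N by rewrite !leq_max leqnn orbT.
have le2 : (n <= maxn N (maxn m n))%N by rewrite !leq_max leqnn !orbT.
rewrite inE => /orP[/eqP[-> ->]|]; last first.
  by apply: NP; move: tt'; rewrite -(subnK le0); exact: below.
have [_ tM _] := svalP t; have [_ tM' _] := svalP t'.
apply: (below _ _ (maxn N (maxn m n) - n)%N); rewrite subnK//.
have Kg := Kle le1 Km.
by rewrite -[g]mulg1 tM// tM'// tt'.
Qed.

Variables (q : G -> cantor_space) (M : nat).
Hypothesis q_full : forall x, exists k, K 0%N k /\ agree M x (q k).

(** Here [pi] is the projection to the bottom level [K 0]. Minimality holds because [G] acts
    transitively on each level ([move_to]) and the value at a high level determines any finite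
    number of bits ([thread_det]). *)
Lemma minimal_realization : exists (zeta : Xi G) (pi : cantor_space -> G),
  [/\ minimal_action zeta, forall x, K 0%N (pi x),
    forall k x, K 0%N k -> pi (zeta k x) = (k * pi x)%g
  & forall x, agree M (q (pi x)) x].
Proof.
pose enc (i : nat * G * G) := pickle (i.1.1, idx i.1.2, idx i.2).
pose dec n : nat * G * G :=
  let: (m, a, c) := odflt (0, 0, 0)%N (unpickle n) in (m, e a, e c).
have move_to n k (t : thread) : K n k ->
    exists g, sval (thread_act g t) n 1%g = k.
  move=> Kk; exists (k * (sval t n 1)^-1)%g; have [tK tM _] := svalP t.
  rewrite /= mul1g -[(k / _)%g]mulg1 tM ?mulgVK//.
  by apply: KM => //; exact: KV.
have [||||||||| zeta [phi [psi [phiK [psiK phi_u] zetaE psi_cont phi_cont]]]] :=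
  @realize G thread _ thread_bit dec enc thread_act (fun t => q (sval t 0%N 1%g)) M.
- by move=> [[n g] k]; rewrite /dec /enc pickleK /= !idxK.
- exact: thread_bit_inj.
- exact: thread_bit_closed.
- move=> g [[n h] k]; exists [:: (n, (h * g)%g, k)] => t t' /(_ (n, (h * g)%g, k)).
  by rewrite inE eqxx; apply.
- by move=> t; apply: thread_eq => n g /=; rewrite mulg1.
- by move=> g h t; apply: thread_eq => n k /=; rewrite mulgA.
- move=> i _; have [s sP] := bits_agree_thread [:: (0%N, 1%g)].
  by exists s => t t' /sP tt'; rewrite (tt' 0%N 1%g)// inE.
- move=> x; have [k [Kk xk]] := q_full x; have [y yT] := thread_exists.
  have [g gk] := move_to 0%N k (exist _ y yT) Kk.
  by exists (thread_act g (exist _ y yT)); rewrite gk.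
- move=> t s; have [L LP] := thread_bits_agree s; have [N NP] := thread_det L.
  (* Perfectness: [v] lies outside [K N] and [h] corrects the value at level [N], so translating by
     [h * v] moves the thread at a higher level but not at level [N]. *)
  have [m [v [Kv nKv]]] := Kinf N; have [tK tM _] := svalP t.
  pose h := (sval t N 1%g * (sval t N v)^-1)%g.
  have Kh : K N h by apply: KM => //; exact: KV.
  exists (thread_act (h * v)%g t); split.
    move=> e1; apply: nKv.
    have le1 : (m <= maxn m N)%N := leq_maxl _ _.
    have le2 : (N <= maxn m N)%N := leq_maxr _ _.
    have Khv : K (maxn m N) (h * v)%g by apply: KM; [exact: Kle Kh|exact: Kle Kv].
    have /esym : sval (thread_act (h * v)%g t) (maxn m N) 1%g =
        sval t (maxn m N) 1%g by rewrite e1.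
    rewrite /= mul1g -[(h * v)%g]mulg1 tM// -{1}[sval t _ _]mul1g => /mulIg hv.
    by rewrite -[v](mulKg h) -hv mulg1; exact: KV.
  apply: LP; apply: NP; rewrite /= mul1g tM//.
  by rewrite /h mulgVK.
exists zeta, (fun x => sval (psi x) 0%N 1%g); split.
- move=> A cA [x Ax] Ainv; apply/seteqP; split=> // y _.
  apply: cA => U /nbhs_agreeP [n nU].
  have [s sP] := phi_cont (psi y) n; have [L LP] := thread_bits_agree s.
  have [N NP] := thread_det L; have [yK _ _] := svalP (psi y).
  have [g gy] := move_to N _ (psi x) (yK N 1%g).
  exists (zeta g x); split; first exact: Ainv.
  apply: nU => /=; rewrite -[y]psiK -[x]psiK -zetaE; apply: sP; apply: LP; apply: NP.
  by rewrite gy.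
- by move=> x; have [] := svalP (psi x).
- move=> k x Kk; rewrite -{1}[x]psiK -zetaE phiK /= mul1g.
  by have [_ tM _] := svalP (psi x); rewrite -[in LHS](mulg1 k) tM.
- by move=> x; have := phi_u (psi x); rewrite psiK.
Qed.

End Tower.

(** * Counting equivariant maps on a large finite subgroup *)

Lemma linear_lt_exp (c d : nat) :
  exists B, forall m, (B <= m)%N -> (c * m < 2 ^ (m - d))%N.
Proof.
(* The bound at the threshold follows from [i < 2 ^ i] and its cube. Beyond it, a unit step doubles
   the right side and adds only [c], which is smaller than the right side, to the left. *)
pose i := (c + d).+1; exists (d + 3 * i)%N.
have h0 : (c * (d + 3 * i) < 2 ^ (3 * i))%N.
  rewrite mulnC expnM -[(2 ^ 3)%N]/8 mulnC.
  have : (i ^ 3 < 8 ^ i)%N.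
    have -> : (8 ^ i = (2 ^ i) ^ 3)%N by rewrite -expnM mulnC expnM.
    by rewrite ltn_exp2r// ltn_expl.
  have : (i < 2 ^ i)%N by rewrite ltn_expl.
  have -> : (8 ^ i = (2 ^ i) ^ 3)%N by rewrite -expnM mulnC expnM.
  move: (2 ^ i)%N; rewrite /i !expnS !expn0 !muln1 => x.
  nia.
move=> m /subnK <-; elim: (m - _)%N => [|k IHk].
  by rewrite add0n [X in (X - d)%N]addnC addnK.
have -> : (k.+1 + (d + 3 * i) - d = (k + (d + 3 * i) - d).+1)%N by lia.
have ltcE : (k + (d + 3 * i) - d < 2 ^ (k + (d + 3 * i) - d))%N by rewrite ltn_expl.
rewrite expnS addSn mulnS; move: IHk ltcE; rewrite /i.
by move: (2 ^ _)%N (c * _)%N => E X; lia.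
Qed.

Section LocallyFinite.
Variable G : groupType.
Hypothesis G_lf : locally_finite G.
Hypothesis G_inf : forall s : seq G, exists g, g \notin s.

Lemma large_uniq_seq n : exists s : seq G, uniq s /\ size s = n.
Proof.
elim: n => [|n [s [us <-]]]; first by exists [::].
by have [g gs] := G_inf s; exists (g :: s); rewrite /= gs us.
Qed.

(** An [H]-equivariant map is arbitrary on coset representatives. The first [P] of the [m]
    representatives in [K0] realize all words of length [M]; the head bits at the other [m - P] are
    free. One map has at most [size Ks] patterns, which is linear in [m], whereas the [2 ^ (m - P)]
    maps have distinct patterns at [k0 = 1]; hence they cannot all share one set of patterns. *)
Lemma two_equivariant_maps (H : set G) (eta : Xi G) M : (0 < M)%N ->
  subgroup H -> finite_set H ->
  exists (K0 : set G) (Ks : seq G), [/\ subgroup K0, finite_set K0, H `<=` K0,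
    forall g, g \in Ks <-> K0 g &
  exists q : bool -> G -> cantor_space, [/\
    forall b h g, H h -> q b (h * g)%g = eta h (q b g),
    forall b x, exists k, K0 k /\ agree M x (q b k)
  & [set [seq head_bit (q true (k * k0)%g) | k <- Ks] | k0 in K0] <>
    [set [seq head_bit (q false (k * k0)%g) | k <- Ks] | k0 in K0]]].
Proof.
move=> M0 Hsub Hfin.
have [Hs [uHs HsP]] := finite_set_seq Hfin.
have [p [pH pM pid]] := subgroup_retraction Hsub.
pose r g := ((p g)^-1 * g)%g.
have gE g : g = (p g * r g)%g by rewrite /r mulgA mulgV mul1g.
have [H1 HM HV] := Hsub.
have pr g : p (r g) = 1%g by rewrite /r pM ?mulVg//; exact: HV.
have rM h g : H h -> r (h * g)%g = r g.
  by move=> Hh; rewrite /r pM// invgM mulgA mulgVK.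
have rr g : r (r g) = r g by rewrite {1}/r pr invg1 mul1g.
pose P := #|{: M.-tuple bool}|.
have [B BP] := linear_lt_exp (size Hs) P.
(* More than [size Hs * B] elements force [K0] to contain at least [B] cosets of [H]. *)
have [s [us sz]] := large_uniq_seq (size Hs * B).+1.
have [K0 [Ksub Kfin KP]] := locally_finite_subgroup (Hs ++ s) G_lf.
have [Ks [uKs KsP]] := finite_set_seq Kfin.
have HK : H `<=` K0 by move=> h /HsP hs; apply: KP; rewrite mem_cat hs.
have [K1 KM KV] := Ksub.
pose reps := undup (map r Ks); pose m := size reps.
have reps_r g : g \in reps -> r g = g /\ K0 g.
  rewrite mem_undup => /mapP [k /KsP Kk ->]; split; first exact: rr.
  by apply: KM => //; apply: KV; exact: HK.
have szKs : (size Ks <= size Hs * m)%N.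
  rewrite -(size_allpairs (fun h k : G => (h * k)%g)); apply: uniq_leq_size => // g gK.
  apply/allpairsP; exists (p g, r g); split=> /=; [exact/HsP| |exact: gE].
  by rewrite mem_undup; exact: map_f.
have szB : (B <= m)%N.
  have : (size s <= size Ks)%N.
    by apply: uniq_leq_size => // g gs; apply/KsP; apply: KP; rewrite mem_cat gs orbT.
  by rewrite sz => /(leq_trans)/(_ szKs); rewrite ltn_mul2l => /andP[_ /ltnW].
have [mP ltP] : (P <= m)%N /\ (size Ks < 2 ^ (m - P))%N.
  have lt2 := leq_ltn_trans szKs (BP m szB); split=> //.
  rewrite leqNgt; apply/negP => /ltnW; rewrite -subn_eq0 => /eqP e0.
  move: lt2; rewrite e0 expn0 ltnS leqn0 size_eq0 => /eqP Ks0.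
  by have /KsP := K1; rewrite Ks0.
pose ext (s : seq bool) : cantor_space := fun i => nth false s i.
pose x (beta : (m - P).-tuple bool) g : cantor_space :=
  let i := index g reps in
  if (i < P)%N then ext (nth [tuple of nseq M false] (enum {: M.-tuple bool}) i)
  else fun=> nth false beta (i - P).
pose q beta g := eta (p g) (x beta (r g)).
have qM beta h g : H h -> q beta (h * g)%g = eta h (q beta g).
  by move=> Hh; rewrite /q pM// rM// gmulfM.
have q_rep beta g : g \in reps -> q beta g = x beta g.
  by move=> /reps_r [rg _]; rewrite /q rg -{1}rg pr gmulf1.
have ureps : uniq reps by exact: undup_uniq.
have q_full beta y : exists k, K0 k /\ agree M y (q beta k).
  have szy : size (mkseq y M) == M by rewrite size_mkseq.
  pose i := index (Tuple szy) (enum {: M.-tuple bool}).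
  have ltiP : (i < P)%N by rewrite /P cardE index_mem mem_enum.
  have ltim : (i < m)%N by exact: leq_trans ltiP mP.
  have nr : nth 1%g reps i \in reps by exact: mem_nth.
  exists (nth 1%g reps i); split; first by have [] := reps_r _ nr.
  rewrite q_rep// /x index_uniq// ltiP nth_index ?mem_enum//.
  by move=> j ltjM; rewrite /ext /= nth_mkseq.
pose L beta := [set [seq head_bit (q beta (k * k0)%g) | k <- Ks] | k0 in K0].
have [beta [beta' neL]] : exists beta beta', L beta <> L beta'.
  apply: contrapT => /forallNP neL.
  pose b0 := [tuple of nseq (m - P) false].
  have eqL beta : L beta = L b0.
    by apply: contrapT; have /forallNP := neL beta; apply.
  pose own beta := [seq head_bit (q beta k) | k <- Ks].
  have own_inj : injective own.
    move=> beta beta' /eq_in_map ownE; apply: val_inj.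
    apply: (@eq_from_nth _ false); rewrite ?size_tuple// => j ltj.
    have ltjm : (P + j < m)%N by rewrite -ltn_subRL.
    have nr : nth 1%g reps (P + j) \in reps by exact: mem_nth.
    have /KsP/ownE : K0 (nth 1%g reps (P + j)) by have [] := reps_r _ nr.
    by rewrite !q_rep// /x index_uniq// ltnNge leq_addr /= /head_bit addKn.
  have : (#|{: (m - P).-tuple bool}| <= size Ks)%N.
    rewrite -(size_map (fun k0 => [seq head_bit (q b0 (k * k0)%g) | k <- Ks])).
    rewrite cardE -(size_map own); apply: uniq_leq_size.
      by rewrite map_inj_uniq ?enum_uniq.
    move=> _ /mapP [beta _ ->].
    have : L beta (own beta).
      by exists 1%g => //; apply: eq_map => k; rewrite mulg1.
    by rewrite eqL => -[k0 /KsP Kk0 <-]; exact: map_f.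
  by rewrite card_tuple card_bool leqNgt ltP.
exists K0, Ks; split=> //.
exists (fun b => if b then q beta else q beta'); split=> //.
- by move=> [] h g Hh; exact: qM.
- by move=> [] y; exact: q_full.
Qed.

End LocallyFinite.

Lemma action_modulus (G : groupType) (zeta : Xi G) (F : seq G) N :
  exists M, [/\ (0 < M)%N, (N <= M)%N & forall g, g \in F ->
    forall x y, agree M x y -> agree N (zeta g x) (zeta g y)].
Proof.
elim: F => [|h F [M [M0 NM MP]]]; first by exists N.+1.
have [m mP] := continuous_agree_unif N (@homeo_fun_continuous (zeta h)).
exists (maxn M m); split; rewrite ?leq_max ?M0 ?NM//.
move=> g; rewrite inE => /orP[/eqP ->|gF] x y xy.
  by apply: mP; apply: agree_le xy; exact: leq_maxr.
by apply: MP => //; apply: agree_le xy; exact: leq_maxl.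
Qed.

(** Since [q b] composed with [pi] is close to the identity, the action built on the tower over [K0]
    is close to [zeta] on [H], which contains [F], and its patterns on [Ks] are those of [q b]. The
    actions obtained are minimal, so the result serves for both spaces of actions. *)
Lemma locally_finite_nowhere_rigid (G : groupType) (M : set (Xi G)) z0 :
  countable [set: G] -> locally_finite G -> ~ finitely_generated [set: G] ->
  (forall zeta, minimal_action zeta -> M zeta) -> nowhere_rigid M z0 [::] 0.
Proof.
move=> Gc lf nfg minM zeta F N _ _ _ _.
have [e [idx idxK]] := countable_enum 1%g Gc.
have inf := not_fg_infinite nfg.
have [H [Hsub Hfin FH]] := locally_finite_subgroup F lf.
have [Hs [_ HsP]] := finite_set_seq Hfin.
have [m [m0 leNm mP]] := action_modulus zeta Hs N.
have [K0 [Ks [Ksub Kfin HK KsP [q [qM q_full neq]]]]] :=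
  two_equivariant_maps lf inf zeta m0 Hsub Hfin.
pose K n := smallest (@subgroup G) (K0 `|` [set e i | i in `I_n]).
have K0E : K 0%N = K0.
  apply/seteqP; split=> [g Kg|]; last by move=> g Kg; apply: sub_gen_smallest; left.
  by apply: Kg; split=> // h [//|[]].
have Kf n : finite_set (K n).
  apply: lf; exists (K0 `|` [set e i | i in `I_n]) => //.
  by rewrite finite_setU; split=> //; exact/finite_image/finite_II.
have KE g : K (idx g).+1 g.
  by apply: sub_gen_smallest; right; exists (idx g) => //=.
have KS n : K n `<=` K n.+1.
  move=> g Kg A [Asub KA]; apply: Kg; split=> // h [Kh|[i /= ltin <-]]; apply: KA.
    by left.
  by right; exists i => //=; exact: ltnW.
have Kinf n : exists m g, K m g /\ ~ K n g.
  have [s [_ sP]] := finite_set_seq (Kf n); have [g gs] := inf s.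
  by exists (idx g).+1, g; split=> // /sP; exact/negP.
have [p pP] : exists p : nat -> G -> G, forall n, [/\ forall g, K n (p n g),
    forall h g, K n h -> p n (h * g)%g = (h * p n g)%g & forall g, K n g -> p n g = g].
  have ex n := subgroup_retraction (@subgroup_smallest G (K0 `|` [set e i | i in `I_n])).
  by have [p pP] := choice ex; exists p.
have real b : exists zeta' : Xi G, [/\ minimal_action zeta', action_nbhs zeta F N zeta' &
    patterns zeta' head_bit Ks =
      [set [seq head_bit (q b (k * k0)%g) | k <- Ks] | k0 in K0]].
  have [|||zeta' [pi [min' piK piM piq]]] :=
    @minimal_realization G e idx idxK K _ Kf KS _ Kinf p pP (q b) m.
  - by move=> n; exact: subgroup_smallest.
  - by move=> g; exists (idx g).+1.
  - by move=> x; rewrite K0E.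
  rewrite K0E in piK piM.
  exists zeta'; split=> //.
    move=> g gF x; have Hg := FH _ gF; have gs : g \in Hs by exact/HsP.
    apply: agree_trans (mP _ gs _ _ (agree_sym (piq x))) _.
    rewrite -qM// -piM; last exact: HK.
    exact: agree_le (piq _).
  have head_pi x : head_bit x = head_bit (q b (pi x)) by rewrite /head_bit piq.
  have pats x : [seq head_bit (zeta' k x) | k <- Ks] =
      [seq head_bit (q b (k * pi x)%g) | k <- Ks].
    by apply/eq_in_map => k /KsP Kk; rewrite head_pi piM.
  apply/seteqP; split=> [_ [x _ <-]|_ [k0 Kk0 <-]].
    by exists (pi x) => //; rewrite pats.
  have [K1 KM KV] := Ksub.
  pose x0 : cantor_space := fun=> false.
  exists (zeta' (k0 * (pi x0)^-1)%g x0) => //; rewrite pats piM ?mulgVK//.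
  by apply: KM => //; exact: KV.
have [z1 [min1 V1 e1]] := real true; have [z2 [min2 V2 e2]] := real false.
exists z1, z2; split; [by split; exact: minM| | |] => //.
by exists Ks; rewrite e1 e2.
Qed.

(** * Groups that are not locally finite *)

Section Ray.
Variables (G : groupType) (S : seq G).

Definition word n : set G := [set x | exists w : n.-tuple G,
  all (fun s => s \in S) w /\ x = foldr (fun s y => y * s)%g 1%g w].

Lemma word0 : word 0 1%g.
Proof. by exists [tuple]. Qed.

Lemma word_rcons n x s : s \in S -> word n x -> word n.+1 (x * s)%g.
Proof. by move=> sS [w [wS ->]]; exists [tuple of s :: w]; rewrite /= sS. Qed.

Lemma wordSP n x : word n.+1 x -> exists s y, [/\ s \in S, word n y & x = (y * s)%g].
Proof.
move=> [w]; case/tupleP: w => s w [/= /andP[sS wS] ->].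
by exists s, (foldr (fun s y => y * s)%g 1%g w); split=> //; exists w.
Qed.

Lemma word0P x : word 0 x -> x = 1%g.
Proof. by move=> [w [_ ->]]; rewrite tuple0. Qed.

Lemma word_mul m n x y : word m x -> word n y -> word (m + n) (x * y)%g.
Proof.
elim: n y => [|n IHn] y mx; first by move=> /word0P ->; rewrite mulg1 addn0.
move=> /wordSP [s [y' [sS ny ->]]]; rewrite mulgA addnS.
by apply: word_rcons => //; exact: IHn.
Qed.

Hypothesis SV : forall s, s \in S -> (s^-1)%g \in S.

Let H := [set x | exists n, word n x].

Lemma words_subgroup : subgroup H.
Proof.
have wordV n x : word n x -> word n (x^-1)%g.
  elim: n x => [|n IHn] x; first by move=> /word0P ->; rewrite invg1; exact: word0.
  move=> /wordSP [s [y [sS ny ->]]]; rewrite invgM -add1n.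
  apply: word_mul; last exact: IHn.
  by rewrite -[(s^-1)%g]mul1g; apply: word_rcons word0; exact: SV.
split=> [|x y [m mx] [n ny]|x [n nx]]; first by exists 0%N; exact: word0.
- by exists (m + n)%N; exact: word_mul.
- by exists n; exact: wordV.
Qed.

Hypothesis Hinf : ~ finite_set H.

(** Word length with respect to [S], with default value [0] outside [H]. *)
Let len x := xget 0%N [set n | word n x /\ forall m, word m x -> (n <= m)%N].

Let lenP x n : word n x -> word (len x) x /\ forall m, word m x -> (len x <= m)%N.
Proof.
move=> nx; apply: (@xgetPex _ 0%N [set n | word n x /\ forall m, word m x -> (n <= m)%N]).
have ex : exists n, `[< word n x >] by exists n; exact/asboolP.
have [k /asboolP kx kmin] := ex_minnP ex; exists k; split=> // m mx.
by apply: kmin; exact/asboolP.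
Qed.

(** The elements whose word length is attained by a path from [1] through [x]: the descendants of
    [x]. *)
Let desc x := [set y | exists u k, [/\ word k u, y = (u * x)%g & len y = (k + len x)%N]].

(** Apart from [x], every descendant of [x] descends from one of the finitely many [s * x] that are
    one step longer, so one of these keeps infinitely many. *)
Let desc_next x : H x -> ~ finite_set (desc x) ->
  exists s, [/\ s \in S, len (s * x)%g = (len x).+1 & ~ finite_set (desc (s * x)%g)].
Proof.
move=> [n nx] inf; apply: contrapT => /forallNP none; apply: inf.
have [lx _] := lenP nx.
apply: (@sub_finite_set _ _ ([set x] `|`
    \bigcup_(s in [set s | s \in S /\ len (s * x)%g = (len x).+1]) desc (s * x)%g)).
  move=> _ [u [[|k] [ku -> ly]]]; first by left; rewrite (word0P ku) mul1g.
  have [s [u' [sS ku' uE]]] := wordSP ku.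
  have w1 : word 1 s by rewrite -[s]mul1g; apply: word_rcons word0.
  have [lsx /(_ _ (word_mul w1 lx)) le1] := lenP (word_mul w1 lx).
  have ux : (u * x = u' * (s * x))%g by rewrite uE mulgA.
  have ls : len (s * x)%g = (len x).+1.
    apply/eqP; rewrite eqn_leq le1 -(leq_add2l k) addnS -addSn -ly ux.
    by have [_] := lenP (word_mul ku' lsx); apply; exact: word_mul.
  right; exists s => //; exists u', k; split=> //.
  by rewrite ly addSnnS ls.
rewrite finite_setU; split; first exact: finite_set1.
apply: bigcup_finite => [|s [sS ls]].
  apply: (@sub_finite_set _ _ [set` S]); last exact: finite_seq.
  by move=> s [].
by apply: contrapT => infs; apply: (none s).
Qed.

(* Koenig's lemma: a geodesic ray in the Cayley graph. *)
Lemma ray_exists : exists r : nat -> G, [/\ r 0%N = 1%g, injective r &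
  forall n, (r n.+1 * (r n)^-1)%g \in S].
Proof.
have len1 : len 1%g = 0%N.
  by have [_ /(_ _ word0)] := lenP word0; rewrite leqn0 => /eqP.
pose good x := H x /\ ~ finite_set (desc x).
have good1 : good 1%g.
  split; first by exists 0%N; exact: word0.
  apply: contra_not Hinf; apply: sub_finite_set => x [n nx].
  by have [lx _] := lenP nx; exists x, (len x); rewrite mulg1 len1 addn0.
have [next nextP] : {next : G -> G & forall x, good x ->
    [/\ good (next x), len (next x) = (len x).+1 & (next x * x^-1)%g \in S]}.
  apply: (@choice _ _ (fun x y =>
    good x -> [/\ good y, len y = (len x).+1 & (y * x^-1)%g \in S])).
  move=> x; have [[Hx infx]|] := pselect (good x); last by exists x.
  have [s [sS ls infs]] := desc_next Hx infx; exists (s * x)%g => _.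
  split; rewrite ?mulgK//; split=> //.
  have [n nx] := Hx; exists (1 + n)%N; apply: word_mul nx.
  by rewrite -[s]mul1g; apply: word_rcons word0.
pose r n := iter n next 1%g.
have rgood n : good (r n) by elim: n => [//|n IHn]; have [] := nextP _ IHn.
have rlen n : len (r n) = n.
  by elim: n => [//|n IHn]; have [_ -> _] := nextP _ (rgood n); rewrite IHn.
exists r; split=> //; first by move=> m n e; rewrite -(rlen m) e rlen.
by move=> n; have [] := nextP _ (rgood n).
Qed.

End Ray.

(** Some finitely generated subgroup is infinite and contains a ray [r] starting at [1]. Left
    multiplication by [c g] pushes each [r n] to [r n.+1] and fixes everything off the ray, so [1]
    is missed. *)
Lemma not_locally_finite_shift (G : groupType) : ~ locally_finite G ->
  exists (S : seq G) (c : G -> G), [/\ uniq S, 1%g \in S, forall g, c g \in S,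
    injective (fun g => c g * g)%g & forall g, (c g * g)%g <> 1%g].
Proof.
move=> nlf.
have [S0 S0inf] : exists S0 : seq G, ~ finite_set (smallest (@subgroup G) [set` S0]).
  apply: contrapT => /forallNP h; apply: nlf => H [A /finite_seqP [s ->] ->].
  by have /contrapT := h s.
pose S := S0 ++ [seq x^-1%g | x <- S0].
have SV s : s \in S -> (s^-1)%g \in S.
  rewrite !mem_cat => /orP[sS|/mapP[x xS ->]]; last by rewrite invgK xS.
  by rewrite [X in _ || X]map_f ?orbT.
have [|r [r0 rinj rS]] := @ray_exists G S.
  apply: contra_not S0inf; apply: sub_finite_set => x Hx; apply: Hx; split.
    exact: words_subgroup.
  move=> s sS; exists 1%N; rewrite -[s]mul1g; apply: word_rcons (word0 _).
  by rewrite mem_cat; apply/orP; left.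
pose c g := if pselect (exists n, r n = g) is left ex then
  (r (xget 0%N [set n | r n = g]).+1 * g^-1)%g else 1%g.
have c_ray n : (c (r n) * r n = r n.+1)%g.
  rewrite /c; case: pselect => [ex|]; last by case; exists n.
  by rewrite mulgVK; congr (r _.+1); apply: rinj; exact: (xgetPex 0%N ex).
have c_off g : ~ (exists n, r n = g) -> (c g * g = g)%g.
  by rewrite /c; case: pselect => // _ _; rewrite mul1g.
exists (undup (1%g :: S)), c; split.
- exact: undup_uniq.
- by rewrite mem_undup inE eqxx.
- move=> g; rewrite mem_undup inE; have [[n <-]|/c_off e] := pselect (exists n, r n = g).
    by rewrite -[c _](mulgK (r n)) c_ray rS orbT.
  by rewrite -[c g](mulgK g) e mulgV eqxx.
- move=> g g'; have [[n <-]|ng] := pselect (exists n, r n = g);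
    have [[n' <-]|ng'] := pselect (exists n, r n = g').
  + by rewrite !c_ray => /rinj [->].
  + by rewrite c_ray (c_off g')// => e; case: ng'; exists n.+1.
  + by rewrite c_ray (c_off g)// => e; case: ng; exists n'.+1.
  + by rewrite !c_off.
- move=> g; have [[n <-]|ng] := pselect (exists n, r n = g).
    by rewrite c_ray -r0 => /rinj.
  by rewrite c_off// => e; apply: ng; exists 0%N; rewrite r0.
Qed.

(* For an action [eta], the sets [A s] cover the space and the sets
   [eta s @` A s] are pairwise disjoint and miss the clopen set [head_bit]; so
   this set is null for every invariant mean. *)
Definition hilbert_hotel (G : groupType) (S : seq G) (A B : G -> set cantor_space)
    (eta : Xi G) : Prop :=
  [/\ forall x, exists2 s, s \in S & A s x,
    forall s s' x, s \in S -> s' \in S -> B s x -> B s' x -> s = s',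
    forall s x, s \in S -> B s x -> ~~ head_bit x,
    forall s x, s \in S -> A s x -> B s (eta s x)
  & exists x, head_bit x].

(** [G] acts by right shift on the compact space [T] of maps [c] into [S] for which [g |-> c g * g]
    is injective. The head bit records whether this injection misses [1]; otherwise [1] is hit from
    exactly one [s^-1], with [c (s^-1) = s], and this [s] gives the disjoint sets [B s]. *)
Lemma hilbert_action (G : groupType) : countable [set: G] -> ~ locally_finite G ->
  exists (z0 : Xi G) (S : seq G) N (A B : G -> set cantor_space), uniq S /\
  forall eta, action_nbhs z0 S N eta -> hilbert_hotel S A B eta.
Proof.
move=> Gc nlf; have [e [idx idxK]] := countable_enum 1%g Gc.
have [S [c0 [uS S1 c0S c0inj c01]]] := not_locally_finite_shift nlf.
pose isT (c : G -> G) := (forall g, c g \in S) /\ injective (fun g => c g * g)%g.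
pose T := {c : G -> G | isT c}.
have T_eq (t t' : T) : (forall g, sval t g = sval t' g) -> t = t'.
  case: t t' => [c cT] [c' cT'] /= cc'; apply: eq_exist.
  exact: functional_extensionality_dep.
pose b (t : T) (i : G * G) := sval t i.1 == i.2.
pose enc (i : G * G) := pickle (idx i.1, idx i.2).
pose dec n : G * G := let: (i, j) := odflt (0, 0)%N (unpickle n) in (e i, e j).
have shiftT k (t : T) : isT (fun g => sval t (g * k)%g).
  have [tS tinj] := svalP t; split=> [g //|g g' gg'].
  by apply: (@mulIg _ k); apply: tinj; rewrite !mulgA gg'.
pose act k (t : T) : T := exist _ _ (shiftT k t).
pose D (t : T) := `[< forall g, (sval t g * g)%g <> 1%g >].
have bits_agree_t (L : seq G) : exists s, forall t t', bits_agree b s t t' ->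
    forall g, g \in L -> sval t g = sval t' g.
  elim: L => [|g L [s sP]]; first by exists [::].
  exists ([seq (g, k) | k <- S] ++ s) => t t' tt' h.
  rewrite inE => /orP[/eqP ->|hL]; last first.
    by apply: sP hL => i si; apply: tt'; rewrite mem_cat si orbT.
  have [tS _] := svalP t'.
  have /tt' : (g, sval t' g) \in [seq (g, k) | k <- S] ++ s by rewrite mem_cat map_f.
  by rewrite /b /= eqxx => /eqP.
(* Missing [1] is a clopen condition: [c g * g = 1] forces [g] to be the inverse of an element of
   [S]. *)
have D_S (t : T) : D t = all (fun s => sval t (s^-1)%g != s) S.
  apply/asboolP/allP => [Dt s sS|h g tg].
    by apply/eqP => e1; apply: (Dt (s^-1)%g); rewrite e1 mulgV.
  have [tS _] := svalP t; have /h := tS g.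
  have -> : ((sval t g)^-1 = g)%g by apply: (mulgI (sval t g)); rewrite mulgV tg.
  by rewrite eqxx.
have [|||||||| z0 [phi [psi [phiK psiK phi_u zetaE psi_cont]]]] :=
  @realize_prod G T _ b dec enc act (fun t => fun=> D t) 1.
- by move=> [g k]; rewrite /dec /enc pickleK /= !idxK.
- move=> t t' tt'; apply: T_eq => g.
  by apply/eqP; have := tt' (g, sval t' g); rewrite /b /= eqxx.
- move=> Y Ylim.
  have Yuniq g k k' : Y (g, k) -> Y (g, k') -> k = k'.
    have [t tY] := Ylim [:: (g, k); (g, k')].
    by rewrite -!tY ?inE ?eqxx ?orbT// /b /= => /eqP <- /eqP <-.
  have Yex g : exists k, Y (g, k).
    have [t tY] := Ylim [seq (g, k) | k <- S]; exists (sval t g).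
    rewrite -tY /b /=; first exact: eqxx.
    by apply: map_f; have [] := svalP t.
  have [y yY] := choice Yex.
  have yt (L : seq G) : exists t : T, forall g, g \in L -> sval t g = y g.
    have [t tY] := Ylim [seq (g, y g) | g <- L]; exists t => g gL.
    apply/eqP; rewrite -[_ == _]/(b t (g, y g)) tY; first exact: yY.
    by apply/mapP; exists g.
  have yT : isT y.
    split=> [g|g g'].
      by have [t tP] := yt [:: g]; rewrite -tP ?inE//; have [] := svalP t.
    have [t tP] := yt [:: g; g']; rewrite -!tP ?inE ?eqxx ?orbT//.
    by have [_ tinj] := svalP t; exact: tinj.
  exists (exist _ _ yT) => -[g k]; rewrite /b /=.
  apply/eqP/idP => [<-|]; first exact: yY.
  exact: Yuniq (yY g).
- move=> g [h k]; exists [:: ((h * g)%g, k)] => t t' /(_ ((h * g)%g, k)).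
  by rewrite inE eqxx; apply.
- by move=> t; apply: T_eq => g /=; rewrite mulg1.
- by move=> g h t; apply: T_eq => k /=; rewrite mulgA.
- move=> i _; have [s sP] := bits_agree_t [seq (s^-1)%g | s <- S]; exists s => t t' /sP tt'.
  rewrite !D_S; apply: eq_in_all => s' s'S; rewrite tt'//.
  by apply/mapP; exists s'.
(* Both values of the head bit must occur: [c0] misses [1], while the constant map [1] yields the
   identity, which does not. *)
- move=> x; case x0: (x 0%N).
    exists (exist isT c0 (conj c0S c0inj)) => -[|//] _; rewrite x0; apply/esym/asboolP.
    exact: c01.
  have cT : isT (fun=> 1%g) by split=> // g g'; rewrite !mul1g.
  exists (exist isT _ cT) => -[|//] _; rewrite x0; apply/esym/asboolPn => /(_ 1%g).
  by rewrite /= mul1g; apply.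
pose A s x := sval (psi x).1 1%g = s.
pose B s x := sval (psi x).1 (s^-1)%g = s.
have [sB sBP] := bits_agree_t [seq (s^-1)%g | s <- S].
have [N NP] := psi_cont sB.
(* [B s] depends on [N] bits only, so [eta s x] still lies in [B s] when [eta] is merely close to
   [z0]. *)
have BN s x y : s \in S -> agree N x y -> B s x -> B s y.
  move=> sS /NP/sBP xy; rewrite /B xy//.
  by apply/mapP; exists s.
have headD x : head_bit x = D (psi x).1.
  by rewrite /head_bit -{1}[x]psiK -phi_u.
exists z0, S, N, A, B; split=> // eta z0eta; split.
- by move=> x; exists (sval (psi x).1 1%g) => //; have [] := svalP (psi x).1.
- move=> s s' x sS s'S Bs Bs'; have [_ tinj] := svalP (psi x).1.
  by apply/invg_inj/tinj; rewrite Bs Bs' !mulgV.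
- move=> s x sS Bs; rewrite headD D_S; apply/negP => /allP/(_ s sS).
  by rewrite Bs eqxx.
- move=> s x sS As; apply: BN (z0eta s sS x) _ => //.
  rewrite /B; have := zetaE s (psi x); rewrite psiK => <-; rewrite phiK /=.
  by rewrite mulVg.
- exists (phi (exist isT c0 (conj c0S c0inj), fun=> true)).
  by rewrite headD phiK; apply/asboolP; exact: c01.
Qed.

(** * Invariant means and null sets *)

Section Mean.
Variables (R : realType) (G : groupType) (mu : set G -> R).
Local Open Scope ring_scope.
Import Order.TTheory GRing.Theory Num.Theory.
Hypothesis mu0 : forall A, 0 <= mu A.
Hypothesis muT : mu setT = 1.
Hypothesis muU : forall A B, A `&` B = set0 -> mu (A `|` B) = mu A + mu B.
Hypothesis muM : forall (g : G) A, mu [set (g * x)%g | x in A] = mu A.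

Lemma mean_le A B : A `<=` B -> mu A <= mu B.
Proof.
move=> AB; rewrite -(setDUK AB) muU ?lerDl//.
by rewrite setDE setICA setICr setI0.
Qed.

Lemma mean_set0 : mu set0 = 0.
Proof.
have := muU (setI0 (set0 : set G)); rewrite setU0 => /eqP.
by rewrite -subr_eq0 opprD addrA subrr add0r oppr_eq0 => /eqP.
Qed.

Lemma mean_setU_le A B : mu (A `|` B) <= mu A + mu B.
Proof.
have AU : A `<=` A `|` B by left.
rewrite -{1}(setDUK AU) muU; last by rewrite setDE setICA setICr setI0.
by rewrite lerD2l; apply: mean_le => x [[]].
Qed.

Let union (L : seq G) (U : G -> set G) := [set g | exists2 s, s \in L & U s g].

Let union_cons s L U : union (s :: L) U = U s `|` union L U.
Proof.
apply/seteqP; split=> g.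
  by move=> [t]; rewrite inE => /orP[/eqP ->|tL Ut]; [left|right; exists t].
move=> [Us|[t tL Ut]]; first by exists s => //; rewrite inE eqxx.
by exists t => //; rewrite inE tL orbT.
Qed.

Let union_nil U : union [::] U = set0.
Proof. by apply/seteqP; split=> g // [s]. Qed.

(** The [U s] cover [G] and their translates lie in the disjoint sets [V s], so the means of the
    [V s] already add up to at least [1] and nothing is left for [D]. *)
Lemma hilbert_null (S : seq G) (U V : G -> set G) (D : set G) : uniq S ->
  (forall g, exists2 s, s \in S & U s g) ->
  (forall s g, s \in S -> U s g -> V s (s * g)%g) ->
  (forall s s' g, s \in S -> s' \in S -> V s g -> V s' g -> s = s') ->
  (forall s g, s \in S -> V s g -> ~ D g) -> mu D = 0.
Proof.
move=> uS cover UV Vdisj VD.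
have sub L : mu (union L U) <= \sum_(s <- L) mu (U s).
  elim: L => [|s L IHL]; first by rewrite big_nil union_nil mean_set0.
  by rewrite union_cons big_cons (le_trans (mean_setU_le _ _))// lerD2l.
have addV L : uniq L -> {subset L <= S} -> mu (union L V) = \sum_(s <- L) mu (V s).
  elim: L => [|s L IHL]; first by rewrite big_nil union_nil mean_set0.
  rewrite /= => /andP[sL uL] LS; rewrite union_cons big_cons -IHL//; last first.
    by move=> t tL; apply: LS; rewrite inE tL orbT.
  apply: muU; apply/seteqP; split=> // g [Vs [t tL Vt]].
  have st : s = t by apply: Vdisj Vs Vt; apply: LS; rewrite inE ?eqxx ?tL ?orbT.
  by move: sL; rewrite st tL.
have le1 : 1 <= \sum_(s <- S) mu (V s).
  rewrite -muT; have -> : [set: G] = union S U.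
    by apply/seteqP; split=> // g _; exact: cover.
  apply: le_trans (sub S) _; rewrite !big_seq; apply: ler_sum => s sS.
  by rewrite -(muM s); apply: mean_le => _ [g Ug <-]; exact: UV.
have disj : D `&` union S V = set0.
  by apply/seteqP; split=> // g [Dg [s sS Vs]]; exact: (VD s g).
have := mean_le (@subsetT _ (D `|` union S V)); rewrite muT muU// addV//.
rewrite -lerBrDr => le_D; apply/eqP; rewrite eq_le mu0 andbT.
by apply: le_trans le_D _; rewrite subr_le0.
Qed.

(** Finitely many translates of a null set have a null union, which cannot be all of [G]. *)
Lemma null_avoid (D : set G) (L : seq G) : mu D = 0 ->
  exists g, forall k, k \in L -> ~ D (k * g)%g.
Proof.
move=> D0; pose E (L : seq G) := [set g | exists2 k, k \in L & D (k * g)%g].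
have E0 : mu (E L) = 0.
  elim: L => [|k L IHL].
    by have -> : E [::] = set0; [apply/seteqP; split=> // g [k]|exact: mean_set0].
  apply/eqP; rewrite eq_le mu0 andbT.
  rewrite -[leRHS]addr0 -{1}D0 -(muM k^-1%g D) -IHL.
  apply: le_trans (mean_setU_le _ _); apply: mean_le => g [h].
  rewrite inE => /orP[/eqP -> Dk|hL Dh]; last by right; exists h.
  by left; exists (k * g)%g => //; rewrite mulKg.
apply: contrapT => /forallNP none.
suff ET : E L = setT by move: E0; rewrite ET muT => /eqP; rewrite oner_eq0.
apply/seteqP; split=> // g _; apply: contrapT => nE; apply: (none g) => k kL Dk.
by apply: nE; exists k.
Qed.

End Mean.

(** * Systems coinduced from a subgroup *)

Section Coinduction.
Variables (G : groupType) (H : set G) (zeta : Xi G).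
Hypothesis Hsub : subgroup H.

Let H1 : H 1%g. Proof. by have [] := Hsub. Qed.
Let HM g h : H g -> H h -> H (g * h)%g. Proof. have [_ + _] := Hsub; exact. Qed.
Let HV g : H g -> H g^-1%g. Proof. have [_ _ +] := Hsub; exact. Qed.

(** The space coinduced from the restriction of [zeta] to [H]; [G] acts on it by right translation
    of the argument. *)
Definition coinduced : set (G -> cantor_space) :=
  [set y | forall h g, H h -> y (h * g)%g = zeta h (y g)].

Lemma coinduced_nonempty : coinduced !=set0.
Proof.
have [p [pH pM _]] := subgroup_retraction Hsub.
exists (fun g => zeta (p g) (fun=> false)) => h g Hh.
by rewrite pM// gmulfM.
Qed.

(** Values on different cosets [H a] are independent, so one coset can be overwritten by the orbit
    of any [x]. *)
Lemma coinduced_override (y : G -> cantor_space) a x : coinduced y ->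
  coinduced (fun g => if `[< H (g * a^-1)%g >] then zeta (g * a^-1)%g x else y g).
Proof.
move=> Yy h g Hh /=; rewrite -mulgA.
have -> : `[< H (h * (g * a^-1))%g >] = `[< H (g * a^-1)%g >].
  apply: asbool_equiv_eq; split=> Hg; last exact: HM.
  by rewrite -[(g * a^-1)%g](mulKg h); apply: HM => //; exact: HV.
by case: ifP => _; [rewrite gmulfM|exact: Yy].
Qed.

Definition pointwise_closed (C : set (G -> cantor_space)) : Prop :=
  forall y : G -> cantor_space, (forall L : seq (G * nat), exists2 y', C y' &
    forall i, i \in L -> y' i.1 i.2 = y i.1 i.2) -> C y.

Lemma coinduced_closed : pointwise_closed coinduced.
Proof.
move=> y ylim h g Hh; apply: functional_extensionality_dep => i.
have [m mP] := continuous_agree_unif i.+1 (@homeo_fun_continuous (zeta h)).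
have [y' Yy' yy'] := ylim (((h * g)%g, i) :: [seq (g, j) | j <- iota 0 m]).
rewrite -(yy' ((h * g)%g, i)) ?inE ?eqxx//= Yy'//.
apply: mP => // j ltjm; apply: (yy' (g, j)).
by rewrite inE map_f ?orbT// mem_iota.
Qed.

(** A point [y] of [C] is coded so that its first [M] bits are those of [y 1]. For [g] in [F],
    equivariance gives [y g = zeta g (y 1)], so right translation becomes an action close to [zeta]
    on [F]. *)
Lemma realize_coinduced (C : set (G -> cantor_space)) (F : seq G) N :
  countable [set: G] -> C `<=` coinduced -> (forall g, g \in F -> H g) ->
  pointwise_closed C -> (forall k y, C y -> C (fun g => y (g * k)%g)) ->
  (forall x, exists2 y, C y & y 1%g = x) ->
  exists zeta' : Xi G, action_nbhs zeta F N zeta' /\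
    forall K, patterns zeta' head_bit K = [set [seq head_bit (y k) | k <- K] | y in C].
Proof.
move=> Gc CY FH Ccl Csh Cfull; have [e [idx idxK]] := countable_enum 1%g Gc.
have [M [M0 NM MP]] := action_modulus zeta F N.
pose T := {y : G -> cantor_space | C y}.
have T_eq (t t' : T) : (forall g, sval t g = sval t' g) -> t = t'.
  case: t t' => [c cT] [c' cT'] /= cc'; apply: eq_exist.
  exact: functional_extensionality_dep.
pose b (t : T) (i : G * nat) := sval t i.1 i.2.
pose enc (i : G * nat) := pickle (idx i.1, i.2).
pose dec n : G * nat := let: (i, j) := odflt (0, 0)%N (unpickle n) in (e i, j).
pose act k (t : T) : T := exist _ _ (Csh k _ (svalP t)).
have [|||||||| zeta' [phi [psi [phiK psiK phi_u zetaE psi_cont]]]] :=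
  @realize_prod G T _ b dec enc act (fun t => sval t 1%g) M.
- by move=> [g k]; rewrite /dec /enc pickleK /= !idxK.
- move=> t t' tt'; apply: T_eq => g; apply: functional_extensionality_dep => i.
  exact: (tt' (g, i)).
- move=> Y Ylim; have CY' : C (fun g i => Y (g, i)).
    apply: Ccl => L; have [t tY] := Ylim L; exists (sval t); first exact: svalP.
    by move=> [g i] /tY.
  by exists (exist _ _ CY') => -[g i].
- move=> g [h k]; exists [:: ((h * g)%g, k)] => t t' /(_ ((h * g)%g, k)).
  by rewrite inE eqxx; apply.
- by move=> t; apply: T_eq => g /=; rewrite mulg1.
- by move=> g h t; apply: T_eq => k /=; rewrite mulgA.
- move=> i _; exists [:: (1%g, i)] => t t' /(_ (1%g, i)).
  by rewrite inE eqxx; apply.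
- by move=> x; have [y Cy <-] := Cfull x; exists (exist _ y Cy).
have near_psi g x : agree M (sval (psi x).1 g) (zeta' g x).
  have := zetaE g (psi x); rewrite psiK => <-.
  by have := phi_u (act g (psi x).1, (psi x).2); rewrite /= mul1g.
have near1 x : agree M (sval (psi x).1 1%g) x.
  by have := phi_u (psi x); rewrite psiK.
exists zeta'; split=> [g gF x|K].
  apply: agree_trans (MP _ gF _ _ (agree_sym (near1 x))) _.
  rewrite -(CY _ (svalP (psi x).1)) ?mulg1; last exact: FH.
  exact: agree_le (near_psi g x).
apply/seteqP; split=> [_ [x _ <-]|_ [y Cy <-]].
  exists (sval (psi x).1); first exact: svalP.
  by apply: eq_map => k; exact: near_psi.
exists (phi (exist _ y Cy, fun=> false)) => //; apply: eq_map => k.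
by have /(_ k _ 0%N M0) := near_psi; rewrite /head_bit => <-; rewrite phiK.
Qed.

(** In the full coinduced system [head_bit] can hold at both [1] and [g1], which lie in different
    cosets; in the subsystem [C] the visits stay in one coset. The avoiding point [y0] fills the
    other cosets, so that [C] still takes every value at [1]. *)
Lemma coinduced_two_actions (F : seq G) N y0 g1 :
  countable [set: G] -> (forall g, g \in F -> H g) -> ~ H g1 ->
  coinduced y0 -> (forall g, ~~ head_bit (y0 g)) -> (exists x, head_bit x) ->
  exists zeta1 zeta2 : Xi G, [/\ action_nbhs zeta F N zeta1, action_nbhs zeta F N zeta2 &
    exists K, patterns zeta1 head_bit K <> patterns zeta2 head_bit K].
Proof.
move=> Gc FH nHg1 Yy0 y0h [xD hxD].
pose over x a (y : G -> cantor_space) g :=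
  if `[< H (g * a^-1)%g >] then zeta (g * a^-1)%g x else y g.
have over1 x a y : over x a y a = x by rewrite /over mulgV asboolT// gmulf1.
pose C := coinduced `&` [set y | forall g g', head_bit (y g) -> head_bit (y g') ->
  H (g' * g^-1)%g].
have C_over x : C (over x 1%g y0).
  split; first exact: coinduced_override.
  move=> g g'; rewrite /over !invg1 !mulg1.
  case: asboolP => [Hg _|_ hg]; last by have := y0h g; rewrite hg.
  case: asboolP => [Hg' _|_ hg']; last by have := y0h g'; rewrite hg'.
  by apply: HM => //; exact: HV.
have [||| zeta1 [V1 pat1]] := @realize_coinduced coinduced F N Gc _ FH coinduced_closed.
- by [].
- by move=> k y Yy h g Hh; rewrite -(mulgA h g k); exact: Yy.
- move=> x; exists (over x 1%g y0) => //; exact: coinduced_override.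
have [|||| zeta2 [V2 pat2]] := @realize_coinduced C F N Gc _ FH.
- by move=> y [].
- move=> y ylim; split.
    by apply: coinduced_closed => L; have [y' [Yy' _] yy'] := ylim L; exists y'.
  move=> g g'; have [y' [_ Cy'] yy'] := ylim [:: (g, 0%N); (g', 0%N)].
  rewrite /head_bit -(yy' (g, 0%N)) ?inE ?eqxx// -(yy' (g', 0%N)) ?inE ?eqxx ?orbT//.
  exact: Cy'.
- move=> k y [Yy Cy]; split; first by move=> h g Hh; rewrite -(mulgA h g k); exact: Yy.
  move=> g g' hg hg'; have := Cy _ _ hg hg'.
  by rewrite invgM mulgA mulgK.
- by move=> x; exists (over x 1%g y0).
exists zeta1, zeta2; split=> //; exists [:: 1%g; g1]; rewrite pat1 pat2 => e.
have : [set [seq head_bit (y k) | k <- [:: 1%g; g1]] | y in C] [:: true; true].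
  rewrite -e; exists (over xD 1%g (over xD g1 y0)).
    by apply: coinduced_override; exact: coinduced_override.
  rewrite /= over1 hxD /over invg1 mulg1 asboolF//.
  by rewrite -[if _ then _ else _]/(over xD g1 y0 g1) over1 hxD.
move=> [y [_ Cy] [h1 hg1]]; apply: nHg1.
by have := Cy _ _ h1 hg1; rewrite invg1 mulg1.
Qed.

(* Translates of any coinduced point avoid the null set [head_bit] on larger
   and larger finite sets; an ultrafilter limit avoids it everywhere. *)
Lemma coinduced_avoiding (R : realType) (S : seq G) A B :
  amenable G R -> uniq S -> (forall s, s \in S -> H s) ->
  hilbert_hotel S A B zeta ->
  exists2 y0, coinduced y0 & forall g, ~~ head_bit (y0 g).
Proof.
move=> [mu [mu0 muT muU muM]] uS SH [cover Bdisj Bhead AB _].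
have [y Yy] := coinduced_nonempty.
have null : mu [set g | head_bit (y g)] = 0%R.
  apply: (@hilbert_null R G mu mu0 muT muU muM S (fun s => [set g | A s (y g)])
    (fun s => [set g | B s (y g)]) _ uS).
  - by move=> g; exact: cover.
  - by move=> s g sS /= As; rewrite Yy; [exact: AB|exact: SH].
  - by move=> s s' g sS s'S; exact: Bdisj.
  - by move=> s g sS /Bhead /negP; exact.
pose good (L : seq G) := [set g | forall k, k \in L -> ~~ head_bit (y (k * g)%g)].
pose F0 := filter_from [set: seq G] good.
have F0F : ProperFilter F0.
  apply: filter_from_proper.
    apply: filter_from_filter; first by exists [::].
    move=> L L' _ _; exists (L ++ L') => // g gP; split=> k kL; apply: gP.
      by rewrite mem_cat kL.
    by rewrite mem_cat kL orbT.
  move=> L _; have [g gP] := null_avoid mu0 muT muU muM L null.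
  by exists g => k /gP /negP.
have [U [UU F0U]] := ultraFilterLemma F0F.
(* The bitwise limit along [U] of the translates of [y] by [k]. *)
pose y0 g : cantor_space := fun i => `[< U [set k | y (g * k)%g i = true] >].
have y0P g i : U [set k | y (g * k)%g i = y0 g i].
  rewrite /y0; case: asboolP => // nU.
  have [//|] := in_ultra_setVsetC [set k | y (g * k)%g i = true] UU.
  by apply: filterS => k /=; case: (y _ _).
have y0m g m : U [set k | agree m (y0 g) (y (g * k)%g)].
  elim: m => [|m IHm]; first by apply: filterS filterT => k _ i.
  apply: filterS (filterI IHm (y0P g m)) => k [/= h1 h2] i.
  by rewrite ltnS leq_eqVlt => /orP[/eqP ->|/h1].
exists y0.
  move=> h g Hh; apply: functional_extensionality_dep => i.
  have [m mP] := continuous_agree_unif i.+1 (@homeo_fun_continuous (zeta h)).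
  have [k [h1 h2]] := filter_ex (filterI (y0m (h * g)%g i.+1) (y0m g m)).
  by rewrite (h1 i)// -mulgA Yy//; apply/esym; exact: mP.
move=> g; have Ug : U (good [:: g]) by apply: F0U; exists [:: g].
have [k [h1 h2]] := filter_ex (filterI (y0m g 1%N) Ug).
by rewrite /head_bit (h1 0%N)//; apply: h2; rewrite inE.
Qed.

End Coinduction.

Theorem corollary1p9 (R : realType) (G : groupType)
    (G_countable : countable [set: G])
    (G_amenable : amenable G R)
    (G_not_fg : ~ finitely_generated [set: G]) :
  (~ exists xi : Xi G, comeager (conjugacy_class xi)) /\
  (locally_finite G ->
   ~ exists xi : Xi_min G, comeager (conjugacy_class_min xi)).
Proof.
split=> [[xi]|lf [xi]]; last first.
  apply: (@no_comeager_class_min G xi [::] 0) => //.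
  exact: locally_finite_nowhere_rigid.
have [lf|nlf] := pselect (locally_finite G).
  apply: (@no_comeager_class G xi xi [::] 0) => //.
  exact: locally_finite_nowhere_rigid.
have [z0 [S [N0 [A [B [uS hotel]]]]]] := hilbert_action G_countable nlf.
(* Every [zeta] in the basic set at [z0] inherits the hotel, and refinements only enlarge [F], so
   [S] stays inside [H]. *)
apply: (@no_comeager_class G xi z0 S N0) => // zeta F N _ z0zeta SF leN.
pose H := smallest (@subgroup G) [set` F].
have FH g : g \in F -> H g by move=> gF; exact: sub_gen_smallest.
(* [H] is finitely generated and [G] is not, which provides a second coset. *)
have [g1 nHg1] : exists g1, ~ H g1.
  apply: contrapT => /forallNP HT; apply: G_not_fg; exists [set` F].
    exact: finite_seq.
  by apply/seteqP; split=> // g _; apply: contrapT => /HT.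
have zeta_hotel := hotel _ z0zeta.
have Hsub : subgroup H by exact: subgroup_smallest.
have [|y0 Yy0 y0h] := coinduced_avoiding Hsub G_amenable uS _ zeta_hotel.
  by move=> s /SF /FH.
have [_ _ _ _ hex] := zeta_hotel.
have [z1 [z2 [V1 V2 ne]]] := coinduced_two_actions Hsub N G_countable FH nHg1 Yy0 y0h hex.
by exists z1, z2.
Qed.
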